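(* Let a real Lie group $G$ have a $C^\infty$ action on a manifold $M$. Assume that the $G$-action on $M$ is both proper and component effective. Let $\ell\in\{1,2,3,\ldots\}$. Then the (prolonged) $G$-action on $\mathcal F^\ell M$ is both proper and free.
   Context: Manifolds are $C^\infty$ real manifolds (not assumed connected). Actions are left actions. $\mathcal F^kM$ denotes the $k$th order frame bundle of $M$: its points over $p\in M$ are the $k$-jets at $0$ of local diffeomorphisms $\varphi$ from a neighborhood of $0$ in $\mathbb R^{\dim M}$ to $M$ with $\varphi(0)=p$. A $C^\infty$ action of $G$ on $M$ induces (by differentiation, ''prolongation'') a $G$-action on $\mathcal F^kM$, $g\cdot j^k_0\varphi=j^k_0(g\circ\varphi)$. An action of a group $G$ on a topological space $X$ is component effective if, for every $g\in G\setminus\{1_G\}$ and every connected component $X^\circ$ of $X$, there exists $x\in X^\circ$ such that $gx\ne x$. Proper action has its usual meaning: $(g,x)\mapsto(gx,x):G\times X\to X\times X$ is a proper map. *)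

(* Defs.v *)
From HB Require Import structures.
From mathcomp Require Import all_boot all_order all_algebra.
From mathcomp Require Import all_classical all_reals all_analysis.

Set Implicit Arguments.
Unset Strict Implicit.
Unset Printing Implicit Defensive.
Import Order.TTheory GRing.Theory Num.Theory.
Import numFieldNormedType.Exports.
Local Open Scope classical_set_scope.
Local Open Scope ring_scope.

Section Calculus.
Context {R : realType} {m : nat} {W : normedModType R}.

(* For s = [:: i_1; ...; i_k], the partial derivative d_(i_1) ... d_(i_k) f. *)
Definition iterD (s : seq 'I_m) (f : 'rV[R]_m -> W) : 'rV[R]_m -> W :=
  foldr (fun i g => 'D_(delta_mx 0 i) g) f s.

(* Only used with U open: f is infinitely (Frechet) differentiable on U. *)
Definition smooth_fun (U : set 'rV[R]_m) (f : 'rV[R]_m -> W) : Prop :=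
  forall s x, U x -> differentiable (iterD s f) x.

End Calculus.

(* Raw local coordinates. Only the values of chart_fun on chart_dom, and those
   of chart_inv on the image of chart_dom, are meaningful. *)
Record chart (R : realType) (n : nat) (M : Type) := Chart {
  chart_dom : set M ;
  chart_fun :> M -> 'rV[R]_n ;
  chart_inv : 'rV[R]_n -> M }.

Definition id_chart (R : realType) (n : nat) : chart R n 'rV[R]_n :=
  Chart setT id id.

Definition prod_chart (R : realType) (m n : nat) (M N : Type)
    (c : chart R m M) (d : chart R n N) : chart R (m + n) (M * N) :=
  Chart (chart_dom c `*` chart_dom d)
        (fun p => row_mx (c p.1) (d p.2))
        (fun z => (chart_inv c (lsubmx z), chart_inv d (rsubmx z))).

Definition prod_atlas (R : realType) (m n : nat) (M N : Type)
    (A : set (chart R m M)) (B : set (chart R n N)) :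
    set (chart R (m + n) (M * N)) :=
  [set e | exists c d, [/\ A c, B d & e = prod_chart c d]].

Definition is_chart (R : realType) (n : nat) (M : topologicalType)
    (c : chart R n M) : Prop :=
  [/\ open (chart_dom c), open (c @` chart_dom c),
      {in chart_dom c, cancel c (chart_inv c)},
      {in chart_dom c, continuous c} &
      {in c @` chart_dom c, continuous (chart_inv c)}].

(* Smoothness, on an open set U, of a map between spaces carrying atlases. *)
Definition smooth_on (R : realType) (m n : nat) (M N : topologicalType)
    (A : set (chart R m M)) (B : set (chart R n N)) (U : set M)
    (f : M -> N) : Prop :=
  {in U, continuous f} /\
  forall c d, A c -> B d ->
    smooth_fun (c @` (chart_dom c `&` U `&` f @^-1` chart_dom d))
               (d \o f \o chart_inv c).

HB.mixin Record isSmoothManifold (R : realType) (n : nat) M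
    & Topological M := {
  manifold_hausdorff : hausdorff_space M ;
  manifold_second_countable : @second_countable M ;
  atlas : set (chart R n M) ;
  atlas_chart : forall c, atlas c -> is_chart c ;
  atlas_cover : forall x, exists2 c, atlas c & chart_dom c x ;
  atlas_compatible : forall c d, atlas c -> atlas d ->
    smooth_fun (c @` (chart_dom c `&` chart_dom d)) (d \o chart_inv c) }.

#[short(type="smoothManifoldType")]
HB.structure Definition SmoothManifold (R : realType) (n : nat) :=
  { M of isSmoothManifold R n M & Topological M }.

Arguments atlas {R n} s.

HB.mixin Record isLieGroup (R : realType) (d : nat) G
    & SmoothManifold R d G & Group G := {
  lie_mul_smooth :
    smooth_on (prod_atlas (@atlas R d G) (@atlas R d G)) (@atlas R d G)
      setT (fun p : G * G => (p.1 * p.2)%g) ;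
  lie_inv_smooth :
    smooth_on (@atlas R d G) (@atlas R d G) setT (fun g : G => g^-1%g) }.

#[short(type="lieGroupType")]
HB.structure Definition LieGroup (R : realType) (d : nat) :=
  { G of isLieGroup R d G & SmoothManifold R d G & Group G }.

Record smoothAction (R : realType) (d n : nat)
    (G : lieGroupType R d) (M : smoothManifoldType R n) := SmoothAction {
  act :> G -> M -> M ;
  act1 : forall x, act 1%g x = x ;
  actM : forall g h x, act (g * h)%g x = act g (act h x) ;
  act_smooth : smooth_on (prod_atlas (atlas G) (atlas M)) (atlas M) setT
    (fun p : G * M => act p.1 p.2) }.

Definition proper_map (X Y : topologicalType) (f : X -> Y) : Prop :=
  continuous f /\ forall K : set Y, compact K -> compact (f @^-1` K).

Definition proper_action (G X : topologicalType) (a : G -> X -> X) : Prop :=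
  proper_map (fun p : G * X => (a p.1 p.2, p.2)).

Definition free_action (G : groupType) (X : Type) (a : G -> X -> X) : Prop :=
  forall g x, a g x = x -> g = 1%g.

Definition component_effective (G : groupType) (X : topologicalType)
    (a : G -> X -> X) : Prop :=
  forall g : G, g <> 1%g -> forall x0 : X,
    exists2 x, connected_component setT x0 x & a g x <> x.

Section Frames.
Context {R : realType} {n : nat} {M : smoothManifoldType R n}.
Implicit Types phi psi : 'rV[R]_n -> M.

Definition Rn_atlas : set (chart R n 'rV[R]_n) := [set id_chart R n].

(* phi restricts to a diffeomorphism from an open neighborhood U of 0 onto an
   open subset V of M; the values of phi off U are irrelevant. *)
Definition local_diffeo phi : Prop :=
  exists (U : set 'rV[R]_n) (V : set M) (psi : M -> 'rV[R]_n),
    [/\ [/\ open U, U 0 & open V],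
        (forall x, U x -> V (phi x) /\ psi (phi x) = x),
        (forall y, V y -> U (psi y) /\ phi (psi y) = y),
        smooth_on Rn_atlas (atlas M) U phi &
        smooth_on (atlas M) Rn_atlas V psi].

Definition jet_eq (k : nat) phi psi : Prop :=
  phi 0 = psi 0 /\
  forall c, atlas M c -> chart_dom c (phi 0) ->
  forall s : seq 'I_n, (size s <= k)%N ->
    iterD s (c \o phi) 0 = iterD s (c \o psi) 0.

(* The k-jet at 0 of phi, as an equivalence class of local diffeomorphisms. *)
Definition jet (k : nat) phi : set ('rV[R]_n -> M) :=
  [set psi | local_diffeo psi /\ jet_eq k phi psi].

End Frames.

Record frame (R : realType) (n : nat) (k : nat) (M : smoothManifoldType R n) :=
  Frame {
  frame_jet :> set ('rV[R]_n -> M) ;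
  frameP : exists2 phi, local_diffeo phi & frame_jet = jet k phi }.

Section FrameBundle.
Context {R : realType} {n k : nat} {M : smoothManifoldType R n}.

Definition frame_of phi (h : local_diffeo phi) : frame k M :=
  Frame (ex_intro2 _ _ phi h erefl).

Definition frame_repr (j : frame k M) : 'rV[R]_n -> M :=
  s2val (cid2 (frameP j)).

Lemma frame_reprP j : local_diffeo (frame_repr j).
Proof. exact: s2valP. Qed.

HB.instance Definition _ := gen_eqMixin (frame k M).
HB.instance Definition _ := gen_choiceMixin (frame k M).

(* The topology of the frame bundle is generated by its standard local
   coordinates: over the domain of a chart c of M, the frame j^k_0 phi has as
   coordinates the partial derivatives of order at most k of c \o phi at 0. *)
Definition frame_subbase : set (set (frame k M)) :=
  [set B | exists c (s : seq 'I_n) (O : set 'rV[R]_n),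
    [/\ atlas M c, (size s <= k)%N, open O &
        B = [set j | chart_dom c (frame_repr j 0) /\
                     O (iterD s (c \o frame_repr j) 0)]]].

HB.instance Definition _ := isSubBaseTopological.Build (frame k M)
  frame_subbase id.

End FrameBundle.

Lemma near_eq_differentiable (R : realType) (V W : normedModType R) (f g : V -> W) (x : V) :
  (\forall y \near x, f y = g y) -> differentiable f x -> differentiable g x.
Proof.
move=> fg /diff_locallyP[cdf df].
have dg : g \o shift x = cst (g x) + 'd f x +o_0 id.
  apply/eqaddoP => e e0; move/eqaddoP: df => /(_ e e0) df.
  have fg0 : \forall h \near (0 : V), f (h + x) = g (h + x).
    have : (fun h : V => h + x) @ (0 : V) --> x.
      rewrite -[X in _ --> X]add0r.
      by apply: cvgD; [exact: cvg_id|exact: cvg_cst].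
    by move=> /(_ _ fg); rewrite nbhs_simpl.
  have fgx := nbhs_singleton fg.
  near=> h.
  have -> : (g \o shift x - (cst (g x) + 'd f x)) h =
            (f \o shift x - (cst (f x) + 'd f x)) h.
    rewrite /= !fctE /= /shift /= fgx.
    suff -> : f (h + x) = g (h + x) by [].
    by near: h.
  by near: h.
by apply/diff_locallyP; rewrite (diff_unique cdf dg).
Unshelve. all: by end_near. Qed.

Section SmoothTheory.
Context {R : realType} {m : nat}.
Local Notation V := 'rV[R]_m.

Lemma near_iterD (W : normedModType R) (f g : V -> W) (s : seq 'I_m) (x : V) :
  (\forall y \near x, f y = g y) ->
  \forall y \near x, iterD s f y = iterD s g y.
Proof.
move=> fg; elim: s => [//|i s IH] /=.
have := nbhs_interior IH; apply: filterS => y yfg.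
exact: near_eq_derive.
Qed.

Lemma eq_iterD (W : normedModType R) (f g : V -> W) (s : seq 'I_m) (x : V) :
  (\forall y \near x, f y = g y) -> iterD s f x = iterD s g x.
Proof. by move=> /near_iterD -/(_ s) /nbhs_singleton. Qed.

Lemma iterD_rcons (W : normedModType R) (f : V -> W) (s : seq 'I_m) i :
  iterD (rcons s i) f = iterD s ('D_(delta_mx 0 i) f).
Proof. by rewrite /iterD foldr_rcons. Qed.

Lemma smooth_fun_near (W : normedModType R) (U : set V) (f : V -> W) :
  (forall x, U x -> exists2 g : V -> W, (\forall y \near x, f y = g y) &
     forall s, differentiable (iterD s g) x) -> smooth_fun U f.
Proof.
move=> H s x /H[g fg /(_ s)]; apply: near_eq_differentiable.
by apply: near_iterD; apply: filterS fg => y ->.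
Qed.

Lemma differentiable_rVP n (f : V -> 'rV[R]_n) (x : V) :
  differentiable f x <-> forall j, differentiable (fun y => f y 0 j) x.
Proof.
split=> [df j|df].
  have -> : (fun y => f y 0 j) = (fun M : 'rV[R]_n => M 0 j) \o f by [].
  by apply: differentiable_comp => //; exact: differentiable_coord.
have -> : f = (\sum_(j < n) (fun y => f y 0 j *: delta_mx 0 j))%R.
  apply/funext => y; rewrite fct_sumE.
  by rewrite [LHS]row_sum_delta.
by apply: differentiable_sum => j; exact: differentiableZl.
Qed.

Lemma nearU (T : topologicalType) (U : set T) (P : T -> Prop) x :
  open U -> U x -> (forall y, U y -> P y) -> \forall y \near x, P y.
Proof. by move=> oU Ux UP; apply: filterS (open_nbhs_nbhs (conj oU Ux)). Qed.

Lemma derive_coord n (f : V -> 'rV[R]_n) (x v : V) j :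
  differentiable f x -> 'D_v (fun y => f y 0 j) x = 'D_v f x 0 j.
Proof. by move=> df; rewrite derive_mx ?mxE//; exact: diff_derivable. Qed.

Lemma iterD_coord n (U : set V) (f : V -> 'rV[R]_n) s j x : open U ->
  smooth_fun U f -> U x -> iterD s (fun y => f y 0 j) x = iterD s f x 0 j.
Proof.
move=> oU sf; elim: s x => [//|i s IH] x Ux /=.
rewrite -derive_coord; last exact: sf.
by apply: near_eq_derive; exact: (nearU oU Ux).
Qed.

Lemma smooth_fun_rVP n (U : set V) (f : V -> 'rV[R]_n) : open U ->
  smooth_fun U f <-> forall j, smooth_fun U (fun y => f y 0 j).
Proof.
move=> oU; split=> [sf j s x Ux|sf].
  apply: near_eq_differentiable (_ : differentiable (fun y => iterD s f y 0 j) x).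
    by apply: (nearU oU Ux) => y Uy; rewrite (iterD_coord _ _ oU).
  by have /differentiable_rVP := sf s x Ux.
have H s x : U x -> iterD s f x = \row_j iterD s (fun y => f y 0 j) x.
  elim: s x => [x Ux|i s IH x Ux] /=; first by apply/rowP => j; rewrite mxE.
  rewrite (@near_eq_derive _ _ _ _ (fun x => \row_j iterD s (fun y => f y 0 j) x)).
    apply/rowP => j; rewrite mxE -derive_coord.
      by congr (derive _ x _); apply/funext => y; rewrite mxE.
    apply/differentiable_rVP => k.
    by under eq_fun do rewrite mxE; exact: sf.
  exact: (nearU oU Ux).
move=> s x Ux.
apply: near_eq_differentiable (_ : differentiable
    (fun x => \row_j iterD s (fun y => f y 0 j) x) x).
  by apply: (nearU oU Ux) => y /H ->.
apply/differentiable_rVP => k.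
by under eq_fun do rewrite mxE; exact: sf.
Qed.

Lemma smooth_fun_derive (W : normedModType R) (U : set V) (f : V -> W) i :
  smooth_fun U f -> smooth_fun U ('D_(delta_mx 0 i) f).
Proof. by move=> sf s x Ux; rewrite -iterD_rcons; exact: sf. Qed.

End SmoothTheory.

Section SmoothScalar.
Context {R : realType} {m : nat}.
Local Notation V := 'rV[R]_m.

Let Ck (k : nat) (U : set V) (f : V -> R) :=
  forall s, (size s <= k)%N -> forall x, U x -> differentiable (iterD s f) x.

Let smoothP (U : set V) (f : V -> R) : smooth_fun U f <-> forall k, Ck k U f.
Proof.
split=> [sf k s _ x|sf s x]; first exact: sf.
exact: (sf (size s)).
Qed.

Let CkS k U f : Ck k.+1 U f <->
  (forall x, U x -> differentiable f x) /\
  forall i, Ck k U ('D_(delta_mx 0 i) f).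
Proof.
split=> [sf|[sf0 sf]].
  split=> [x Ux|i s ks x Ux]; first exact: (sf [::]).
  by rewrite -iterD_rcons; apply: sf => //; rewrite size_rcons.
case/lastP => [_ x Ux|s i]; first exact: sf0.
by rewrite size_rcons ltnS => sk x Ux; rewrite iterD_rcons; exact: sf.
Qed.

Let CkW k U f : Ck k.+1 U f -> Ck k U f.
Proof. by move=> sf s sk; apply: sf; exact: leqW. Qed.

Let Ck_eq k U f g : open U -> (forall x, U x -> f x = g x) ->
  Ck k U f -> Ck k U g.
Proof.
move=> oU fg sf s sk x Ux; apply: near_eq_differentiable (sf s sk x Ux).
exact/near_iterD/(nearU oU Ux).
Qed.

Let CkD k U f g : open U -> Ck k U f -> Ck k U g -> Ck k U (f + g).
Proof.
move=> oU; elim: k f g => [|k IH] f g.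
  move=> sf sg [|//] _ x Ux.
  by apply: differentiableD; [exact: (sf [::])|exact: (sg [::])].
move=> /CkS[sf0 sf] /CkS[sg0 sg]; apply/CkS; split=> [x Ux|i].
  by apply: differentiableD; [exact: sf0|exact: sg0].
apply: Ck_eq (IH _ _ (sf i) (sg i)) => // x Ux.
by rewrite deriveD//; apply: diff_derivable; [exact: sf0|exact: sg0].
Qed.

Let CkM k U f g : open U -> Ck k U f -> Ck k U g -> Ck k U (f * g).
Proof.
move=> oU; elim: k f g => [|k IH] f g.
  move=> sf sg [|//] _ x Ux.
  by apply: differentiableM; [exact: (sf [::])|exact: (sg [::])].
move=> sf' sg'; move: (sf') (sg') => /CkS[sf0 sf] /CkS[sg0 sg].
apply/CkS; split=> [x Ux|i].
  by apply: differentiableM; [exact: sf0|exact: sg0].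
apply: Ck_eq (CkD oU (IH _ _ (CkW sf') (sg i)) (IH _ _ (CkW sg') (sf i))) => //.
move=> x Ux.
by rewrite deriveM//; apply: diff_derivable; [exact: sf0|exact: sg0].
Qed.

Let Ck_cst k U (a : R) : open U -> Ck k U (cst a).
Proof.
move=> oU; elim: k a => [|k IH] a.
  by move=> [|//] _ x Ux; exact: differentiable_cst.
apply/CkS; split=> [x Ux|i]; first exact: differentiable_cst.
by apply: Ck_eq (IH 0) => // x Ux; rewrite derive_cst.
Qed.

Let Ck_sum k U (I : Type) (r : seq I) (f : I -> V -> R) : open U ->
  (forall i, Ck k U (f i)) -> Ck k U (\sum_(i <- r) f i).
Proof.
move=> oU sf; elim: r => [|i r IH].
  by rewrite big_nil; exact: Ck_cst.
by rewrite big_cons; exact: CkD.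
Qed.

Lemma smooth_funD (U : set V) (f g : V -> R) : open U ->
  smooth_fun U f -> smooth_fun U g -> smooth_fun U (f + g).
Proof. by move=> oU /smoothP sf /smoothP sg; apply/smoothP => k; exact: CkD. Qed.

Lemma smooth_funM (U : set V) (f g : V -> R) : open U ->
  smooth_fun U f -> smooth_fun U g -> smooth_fun U (f * g).
Proof. by move=> oU /smoothP sf /smoothP sg; apply/smoothP => k; exact: CkM. Qed.

Lemma derive_comp_rV n (f : V -> 'rV[R]_n) (h : 'rV[R]_n -> R) (x v : V) :
  differentiable f x -> differentiable h (f x) ->
  'D_v (h \o f) x =
  \sum_(j < n) 'D_(delta_mx 0 j) h (f x) * 'D_v (fun y => f y 0 j) x.
Proof.
move=> df dh; rewrite deriveE; last exact: differentiable_comp.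
rewrite diff_comp //= -(deriveE v df) {1}['D_v f x]row_sum_delta linear_sum.
apply: eq_bigr => j _.
by rewrite linearZ /= -deriveE// derive_coord// mulrC.
Qed.

Lemma smooth_fun_comp_scalar n (U : set V) (O : set 'rV[R]_n)
    (f : V -> 'rV[R]_n) (h : 'rV[R]_n -> R) : open U ->
  (forall x, U x -> O (f x)) ->
  smooth_fun U f -> smooth_fun O h -> smooth_fun U (h \o f).
Proof.
move=> oU UO sf sh; apply/smoothP => k; elim: k h sh => [|k IH] h sh.
  move=> [|//] _ x Ux.
  by apply: differentiable_comp; [exact: (sf [::])|exact: (sh [::] _ (UO _ Ux))].
apply/CkS; split=> [x Ux|i].
  by apply: differentiable_comp; [exact: (sf [::])|exact: (sh [::] _ (UO _ Ux))].
pose g j := (('D_(delta_mx 0 j) h) \o f) * 'D_(delta_mx 0 i) (fun y => f y 0 j).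
have sg j : Ck k U (g j).
  apply: CkM => //; first by apply: IH; apply: smooth_fun_derive.
  have /(smooth_fun_rVP _ oU)/(_ j) sfj := sf.
  by have /smoothP := smooth_fun_derive i sfj; exact.
apply: Ck_eq (Ck_sum (index_enum 'I_n) oU sg) => // x Ux.
rewrite derive_comp_rV; [|exact: (sf [::])|exact: (sh [::] _ (UO _ Ux))].
by rewrite fct_sumE.
Qed.

End SmoothScalar.

Section SmoothComp.
Context {R : realType} {m n p : nat}.

Lemma smooth_fun_comp (U : set 'rV[R]_m) (O : set 'rV[R]_n)
    (f : 'rV[R]_m -> 'rV[R]_n) (h : 'rV[R]_n -> 'rV[R]_p) :
  open U -> open O -> (forall x, U x -> O (f x)) ->
  smooth_fun U f -> smooth_fun O h -> smooth_fun U (h \o f).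
Proof.
move=> oU oO UO sf /(smooth_fun_rVP _ oO) sh; apply/(smooth_fun_rVP _ oU) => j.
exact: (smooth_fun_comp_scalar oU UO sf (sh j)).
Qed.

End SmoothComp.

Lemma smooth_funS (R : realType) (m : nat) (W : normedModType R)
    (U U' : set 'rV[R]_m) (f : 'rV[R]_m -> W) :
  U' `<=` U -> smooth_fun U f -> smooth_fun U' f.
Proof. by move=> UU sf s x /UU; exact: sf. Qed.

Lemma smooth_fun_ext (R : realType) (m : nat) (W : normedModType R)
    (U : set 'rV[R]_m) (f g : 'rV[R]_m -> W) :
  open U -> (forall x, U x -> f x = g x) -> smooth_fun U g -> smooth_fun U f.
Proof.
move=> oU fg sg; apply: smooth_fun_near => x Ux; exists g; last first.
  by move=> s; exact: sg.
exact: (nearU oU Ux).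
Qed.

Lemma open_setI_preimage (X Y : topologicalType) (U : set X) (D : set Y)
    (f : X -> Y) :
  open U -> open D -> {in U, continuous f} -> open (U `&` f @^-1` D).
Proof.
move=> oU oD cf; rewrite openE => x [Ux Dfx]; rewrite /interior.
apply: filterI; first exact: open_nbhs_nbhs.
by apply: (cf x); [rewrite inE|exact: open_nbhs_nbhs].
Qed.

Section Atlases.
Context {R : realType}.

Lemma chart_image_open n (M : topologicalType) (c : chart R n M) (S : set M) :
  is_chart c -> open S -> S `<=` chart_dom c -> open (c @` S).
Proof.
move=> [oD oI cK _ ci] oS SD.
rewrite (_ : c @` S = (c @` chart_dom c) `&` (chart_inv c @^-1` S)).
  exact: open_setI_preimage.
apply/seteqP; split=> [_ [x Sx <-]|_ [[x Dx <-]]] /=.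
  by split; [exists x => //; exact: SD|rewrite cK// inE; exact: SD].
by rewrite cK ?inE// => Sx; exists x.
Qed.

Lemma smooth_on_domain_open m n (M N : topologicalType)
    (c : chart R m M) (d : chart R n N) (U : set M) (f : M -> N) :
  is_chart c -> is_chart d -> open U -> {in U, continuous f} ->
  open (chart_dom c `&` U `&` f @^-1` chart_dom d).
Proof.
move=> [oc _ _ _ _] [od _ _ _ _] oU cf; apply: open_setI_preimage => //.
  exact: openI.
by move=> x; rewrite inE => -[_ Ux]; apply: cf; rewrite inE.
Qed.

Lemma smooth_on_comp m n p (M N P : topologicalType)
    (A : set (chart R m M)) (B : set (chart R n N)) (C : set (chart R p P))
    (U : set M) (O : set N) (f : M -> N) (g : N -> P) :
  (forall c, A c -> is_chart c) -> (forall d, B d -> is_chart d) ->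
  (forall e, C e -> is_chart e) ->
  (forall y, O y -> exists2 d, B d & chart_dom d y) ->
  open U -> open O -> (forall x, U x -> O (f x)) ->
  smooth_on A B U f -> smooth_on B C O g -> smooth_on A C U (g \o f).
Proof.
move=> chA chB chC covB oU oO UO [cf sf] [cg sg].
have cgf : {in U, continuous (g \o f)}.
  move=> x; rewrite inE => Ux; apply: continuous_comp.
    by apply: cf; rewrite inE.
  by apply: cg; rewrite inE; exact: UO.
split=> // c e Ac Ce s _ [x [[Dx Ux] Ex] <-].
have [d Bd dfx] := covB _ (UO _ Ux).
pose S := (chart_dom c `&` U `&` f @^-1` chart_dom d) `&`
          (chart_dom c `&` U `&` (g \o f) @^-1` chart_dom e).
have oS : open (c @` S).
  apply: chart_image_open; first exact: chA.
    apply: openI; apply: smooth_on_domain_open => //.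
    - exact: chA.
    - exact: chB.
    - exact: chA.
    - exact: chC.
  by move=> ? [[[]]].
have oT : open (d @` (chart_dom d `&` O `&` g @^-1` chart_dom e)).
  apply: chart_image_open; first exact: chB.
    by apply: smooth_on_domain_open => //; [exact: chB|exact: chC].
  by move=> ? [[]].
have [_ _ cK _ _] := chA _ Ac; have [_ _ dK _ _] := chB _ Bd.
have SS : smooth_fun (c @` S) (e \o (g \o f) \o chart_inv c).
  apply: (@smooth_fun_ext _ _ _ _ _
    ((e \o g \o chart_inv d) \o (d \o f \o chart_inv c))) => //.
    move=> _ [y [[[cy Uy] dy] _] <-] /=.
    by rewrite cK ?inE// dK ?inE.
  apply: smooth_fun_comp oS oT _ _ (sg _ _ Bd Ce).
    move=> _ [y [[[cy Uy] dy] [_ ey]] <-] /=.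
    rewrite cK ?inE//; exists (f y) => //.
    by split=> //; split=> //; exact: UO.
  apply: smooth_funS (sf _ _ Ac Bd).
  by apply: image_subset => y [].
by apply: SS; exists x.
Qed.

Lemma id_is_chart n : is_chart (id_chart R n).
Proof.
split=> //=; rewrite ?image_id; do ?exact: openT.
- by move=> x _; exact: cvg_id.
- by move=> x _; exact: cvg_id.
Qed.

Lemma Rn_atlas_chart n (c : chart R n 'rV[R]_n) : Rn_atlas c -> is_chart c.
Proof. by move=> ->; exact: id_is_chart. Qed.

Lemma continuous_rV n (X : topologicalType) (f : X -> 'rV[R]_n) (x : X) :
  (forall j, {for x, continuous (fun y => f y 0 j)}) -> {for x, continuous f}.
Proof.
move=> cf A [P nP PA].
have : \forall y \near x, forall j, P 0 j (f y 0 j).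
  by apply: filter_forall => j; exact: (cf j _ (nP 0 j)).
by apply: filterS => y Py; apply: PA => i j; rewrite ord1.
Qed.

Lemma prod_is_chart m n (M N : topologicalType)
    (c : chart R m M) (d : chart R n N) :
  is_chart c -> is_chart d -> is_chart (prod_chart c d).
Proof.
move=> [oc ic cK cc cci] [od id dK cd cdi].
have cl : continuous (fun z : 'rV[R]_(m + n) => lsubmx z).
  exact: continuous_lsubmx.
have cr : continuous (fun z : 'rV[R]_(m + n) => rsubmx z).
  exact: continuous_rsubmx.
have imE : prod_chart c d @` chart_dom (prod_chart c d) =
    (lsubmx @^-1` (c @` chart_dom c)) `&` (rsubmx @^-1` (d @` chart_dom d)).
  apply/seteqP; split=> [_ [[x y] [/= cx dy] <-]|z] /=.
    by rewrite row_mxKl row_mxKr; split; [exists x|exists y].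
  move=> [[x cx xz] [y dy yz]]; exists (x, y) => //=.
  by rewrite xz yz hsubmxK.
split.
- rewrite /= (_ : _ `*` _ = fst @^-1` chart_dom c `&` snd @^-1` chart_dom d) //.
  apply: openI.
    by apply: open_comp => // z _; exact: cvg_fst.
  by apply: open_comp => // z _; exact: cvg_snd.
- rewrite imE; apply: openI.
    by apply: open_comp => // z _; exact: cl.
  by apply: open_comp => // z _; exact: cr.
- move=> [x y]; rewrite inE => -[/= cx dy] /=.
  by rewrite row_mxKl row_mxKr cK ?dK// inE.
- move=> [x y]; rewrite inE => -[/= cx dy].
  have ccx : {for x, continuous c} by apply: cc; rewrite inE.
  have cdy : {for y, continuous d} by apply: cd; rewrite inE.
  apply: continuous_rV => j; case: (split_ordP j) => i ->.
    under [X in {for _, continuous X}]eq_fun do rewrite /= row_mxEl.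
    apply: (@continuous_comp _ _ _ (fun p : M * N => c p.1)
      (fun u : 'rV[R]_m => u 0 i)); last exact: coord_continuous.
    by apply: (@continuous_comp _ _ _ fst c) => //; exact: cvg_fst.
  under [X in {for _, continuous X}]eq_fun do rewrite /= row_mxEr.
  apply: (@continuous_comp _ _ _ (fun p : M * N => d p.2)
    (fun u : 'rV[R]_n => u 0 i)); last exact: coord_continuous.
  by apply: (@continuous_comp _ _ _ snd d) => //; exact: cvg_snd.
- move=> z; rewrite imE inE => -[/= lz rz].
  have cl' : {for z, continuous (chart_inv c \o lsubmx)}.
    by apply: continuous_comp; [exact: cl|apply: cci; rewrite inE].
  have cr' : {for z, continuous (chart_inv d \o rsubmx)}.
    by apply: continuous_comp; [exact: cr|apply: cdi; rewrite inE].
  exact: (cvg_pair cl' cr').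
Qed.

End Atlases.


Section ActionMaps.
Context {R : realType} {d n : nat} {G : lieGroupType R d}.
Context {M : smoothManifoldType R n}.
Variable a : smoothAction G M.

Lemma act_continuous (g : G) : continuous (a g).
Proof.
have [ca _] := act_smooth a => x.
have /= cgx := ca (g, x) (in_setT _).
have := @continuous_comp _ _ _ (fun x : M => (g, x))
   (fun p : G * M => a p.1 p.2) x; apply => //.
by apply: cvg_pair; [exact: cvg_cst|exact: cvg_id].
Qed.

Lemma smooth_row_mx (z0 : 'rV[R]_d) (U : set 'rV[R]_n) : open U ->
  smooth_fun U (fun z => row_mx z0 z : 'rV[R]_(d + n)).
Proof.
move=> oU; apply/(smooth_fun_rVP _ oU) => j.
have cstD (b : R) s (x : 'rV[R]_n) : differentiable (iterD s (cst b)) x.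
  elim/last_ind: s b => [|s i IH] b; first exact: differentiable_cst.
  rewrite iterD_rcons (_ : 'D__ _ = cst 0) //.
  by apply/funext => y; rewrite derive_cst.
case: (split_ordP j) => i ->.
  rewrite (_ : (fun _ => _) = cst (z0 0 i)); first by move=> s x _.
  by apply/funext => z; rewrite row_mxEl.
rewrite (_ : (fun _ => _) = (fun z : 'rV[R]_n => z 0 i)); last first.
  by apply/funext => z; rewrite row_mxEr.
move=> s x _; elim/last_ind: s => [|s k IH]; first exact: differentiable_coord.
rewrite iterD_rcons (_ : 'D__ _ = cst ((delta_mx 0 k : 'rV[R]_n) 0 i)) //.
apply/funext => y; rewrite (@derive_coord _ _ _ id) ?derive_id//.
Qed.

Lemma act_smooth1 (g : G) : smooth_on (atlas M) (atlas M) setT (a g).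
Proof.
have cag : {in setT, continuous (a g)} by move=> x _; exact: act_continuous.
split=> // c e Mc Me.
have [ca sa] := act_smooth a.
have [c0 Gc0 c0g] := @atlas_cover R d G g.
have chc := atlas_chart _ Mc; have che := atlas_chart _ Me.
have chc0 := atlas_chart _ Gc0.
have [_ _ c0K _ _] := chc0; have [_ _ cK _ _] := chc.
set S := chart_dom c `&` setT `&` _.
have oS : open (c @` S).
  apply: chart_image_open => //; last by move=> ? [[]].
  by apply: smooth_on_domain_open => //; exact: openT.
pose F := (e \o (fun p : G * M => a p.1 p.2) \o chart_inv (prod_chart c0 c)).
pose L (z : 'rV[R]_n) : 'rV[R]_(d + n) := row_mx (c0 g) z.
have oT : open (prod_chart c0 c @` (chart_dom (prod_chart c0 c) `&` setT `&`
    (fun p : G * M => a p.1 p.2) @^-1` chart_dom e)).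
  have chp := prod_is_chart chc0 chc.
  apply: chart_image_open => //; last by move=> ? [[]].
  by apply: smooth_on_domain_open => //; exact: openT.
apply: (@smooth_fun_ext _ _ _ _ _ (F \o L)) => //.
  move=> _ [x _ <-]; rewrite /F /L /= row_mxKl row_mxKr c0K// inE//.
apply: smooth_fun_comp oS oT _ (smooth_row_mx _ oS) _.
  by move=> _ [x [[cx _] ex] <-]; exists (g, x).
by apply: sa => //; exists c0, c.
Qed.

Lemma act_local_diffeo (g : G) (phi : 'rV[R]_n -> M) :
  local_diffeo phi -> local_diffeo (a g \o phi).
Proof.
move=> [U [V [psi [[oU U0 oV] UV VU sphi spsi]]]].
have aK : cancel (a g) (a g^-1%g) by move=> x; rewrite -actM mulVg act1.
have aVK : cancel (a g^-1%g) (a g) by move=> x; rewrite -actM mulgV act1.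
have oV' : open (a g^-1%g @^-1` V).
  by apply: open_comp => // x _; exact: act_continuous.
exists U, (a g^-1%g @^-1` V), (psi \o a g^-1%g); split.
- by split.
- by move=> x Ux /=; rewrite aK; exact: UV.
- by move=> y /= /VU[? ->]; rewrite aVK.
- apply: (@smooth_on_comp _ _ _ _ _ _ _ _ (atlas M) _ _ setT) => //.
  + exact: Rn_atlas_chart.
  + exact: atlas_chart.
  + exact: atlas_chart.
  + by move=> y _; have [c] := @atlas_cover R n M y; exists c.
  + exact: openT.
  + exact: act_smooth1.
- apply: (@smooth_on_comp _ _ _ _ _ _ _ _ (atlas M) _ _ V) => //.
  + exact: atlas_chart.
  + exact: atlas_chart.
  + exact: Rn_atlas_chart.
  + by move=> y _; have [c] := @atlas_cover R n M y; exists c.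
  + have [ca sa] := act_smooth1 g^-1%g.
    split=> [x _|c e Mc Me]; first exact: act_continuous.
    apply: smooth_funS (sa c e Mc Me).
    by apply: image_subset => x [[? _] ?].
Qed.

End ActionMaps.

Section JetComp.
Context {R : realType} {m : nat}.
Local Notation V := 'rV[R]_m.

Let jeq (k : nat) (f g : V -> R) :=
  forall s, (size s <= k)%N -> iterD s f 0 = iterD s g 0.

Let jeqS k f g : jeq k.+1 f g <->
  f 0 = g 0 /\
  forall i, jeq k ('D_(delta_mx 0 i) f) ('D_(delta_mx 0 i) g).
Proof.
split=> [fg|[fg0 fg]].
  split; first exact: (fg [::]).
  by move=> i s sk; rewrite -!iterD_rcons; apply: fg; rewrite size_rcons.
case/lastP => [//|s i]; rewrite size_rcons ltnS => sk.
by rewrite !iterD_rcons; exact: fg.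
Qed.

Let jeqW k f g : jeq k.+1 f g -> jeq k f g.
Proof. by move=> fg s sk; apply: fg; exact: leqW. Qed.

Let jeq_near k (U : set V) f g f' g' : open U -> U 0 ->
  (forall x, U x -> f x = f' x) -> (forall x, U x -> g x = g' x) ->
  jeq k f' g' -> jeq k f g.
Proof.
move=> oU U0 ff gg fg s sk.
rewrite (eq_iterD s (nearU oU U0 ff)) (eq_iterD s (nearU oU U0 gg)).
exact: fg.
Qed.

Let iterD_add (U : set V) (f g : V -> R) s x : open U ->
  smooth_fun U f -> smooth_fun U g -> U x ->
  iterD s (f + g) x = iterD s f x + iterD s g x.
Proof.
move=> oU sf sg; elim: s x => [//|i s IH] x Ux /=.
rewrite -[RHS]deriveD; [|exact/diff_derivable/sf|exact/diff_derivable/sg].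
by apply: near_eq_derive; exact: (nearU oU Ux).
Qed.

Let jeqD k (U : set V) f1 f2 g1 g2 : open U -> U 0 ->
  smooth_fun U f1 -> smooth_fun U f2 -> smooth_fun U g1 -> smooth_fun U g2 ->
  jeq k f1 f2 -> jeq k g1 g2 -> jeq k (f1 + g1) (f2 + g2).
Proof.
move=> oU U0 sf1 sf2 sg1 sg2 ff gg s sk.
by rewrite !(iterD_add s oU)// ff// gg.
Qed.

Let jeqM k (U : set V) f1 f2 g1 g2 : open U -> U 0 ->
  smooth_fun U f1 -> smooth_fun U f2 -> smooth_fun U g1 -> smooth_fun U g2 ->
  jeq k f1 f2 -> jeq k g1 g2 -> jeq k (f1 * g1) (f2 * g2).
Proof.
move=> oU U0; elim: k f1 f2 g1 g2 => [|k IH] f1 f2 g1 g2 sf1 sf2 sg1 sg2 ff gg.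
  move=> [|//] _ /=; have /= := ff [::] isT; have /= := gg [::] isT.
  by rewrite !fctE => -> ->.
move: (ff) (gg) => /jeqS[ff0 ff'] /jeqS[gg0 gg']; apply/jeqS; split.
  by rewrite !fctE ff0 gg0.
move=> i.
have DM (f g : V -> R) : smooth_fun U f -> smooth_fun U g -> forall x, U x ->
    'D_(delta_mx 0 i) (f * g) x =
    (f * 'D_(delta_mx 0 i) g + g * 'D_(delta_mx 0 i) f) x.
  move=> sf sg x Ux; rewrite deriveM//; apply: diff_derivable.
    exact: (sf [::]).
  exact: (sg [::]).
apply: (jeq_near oU U0 (DM _ _ sf1 sg1) (DM _ _ sf2 sg2)).
have sd (f : V -> R) : smooth_fun U f -> smooth_fun U ('D_(delta_mx 0 i) f).
  exact: smooth_fun_derive.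
apply: (jeqD oU U0); rewrite /=.
- by apply: smooth_funM => //; exact: sd.
- by apply: smooth_funM => //; exact: sd.
- by apply: smooth_funM => //; exact: sd.
- by apply: smooth_funM => //; exact: sd.
- by apply: IH => //; (exact: sd || exact: jeqW).
- by apply: IH => //; (exact: sd || exact: jeqW).
Qed.

Let smooth_fun0 (U : set V) : open U -> smooth_fun U (0 : V -> R).
Proof.
move=> oU s x _; elim/last_ind: s => [|s i IH]; first exact: differentiable_cst.
rewrite iterD_rcons (_ : 'D__ _ = 0) //.
by apply/funext => y; rewrite derive_cst.
Qed.

Let jeq_sum k (U : set V) (I : Type) (r : seq I) (f g : I -> V -> R) :
  open U -> U 0 ->
  (forall i, smooth_fun U (f i)) -> (forall i, smooth_fun U (g i)) ->
  (forall i, jeq k (f i) (g i)) ->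
  [/\ smooth_fun U (\sum_(i <- r) f i), smooth_fun U (\sum_(i <- r) g i) &
      jeq k (\sum_(i <- r) f i) (\sum_(i <- r) g i)].
Proof.
move=> oU U0 sf sg fg; elim: r => [|i r [IHf IHg IH]].
  by rewrite !big_nil; split => //; exact: smooth_fun0.
rewrite !big_cons; split; [exact: smooth_funD|exact: smooth_funD|].
exact: (jeqD oU U0).
Qed.

Lemma iterD_comp_scalar n k (U : set V) (O : set 'rV[R]_n)
    (f1 f2 : V -> 'rV[R]_n) (h : 'rV[R]_n -> R) : open U -> U 0 ->
  (forall x, U x -> O (f1 x)) -> (forall x, U x -> O (f2 x)) ->
  smooth_fun U f1 -> smooth_fun U f2 -> smooth_fun O h ->
  (forall s, (size s <= k)%N -> iterD s f1 0 = iterD s f2 0) ->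
  forall s, (size s <= k)%N -> iterD s (h \o f1) 0 = iterD s (h \o f2) 0.
Proof.
move=> oU U0 UO1 UO2 sf1 sf2.
elim: k h => [|k IH] h sh ff.
  by move=> [|//] _ /=; have /= -> := ff [::] isT.
apply/jeqS; split; first by rewrite /=; have /= -> := ff [::] isT.
move=> i.
pose g (f : V -> 'rV[R]_n) j : V -> R :=
  ('D_(delta_mx 0 j) h \o f) * 'D_(delta_mx 0 i) (fun y => f y 0 j).
have gE (f : V -> 'rV[R]_n) : (forall x, U x -> O (f x)) -> smooth_fun U f -> forall x, U x ->
    'D_(delta_mx 0 i) (h \o f) x = (\sum_(j < n) g f j) x.
  move=> UO sf x Ux.
  rewrite derive_comp_rV; [|exact: (sf [::])|exact: (sh [::] _ (UO _ Ux))].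
  by rewrite fct_sumE.
apply: (jeq_near oU U0 (gE _ UO1 sf1) (gE _ UO2 sf2)).
have sDh j : smooth_fun O ('D_(delta_mx 0 j) h) by exact: smooth_fun_derive.
have sc (f : V -> 'rV[R]_n) j : smooth_fun U f -> smooth_fun U (fun y => f y 0 j).
  by move=> /(smooth_fun_rVP _ oU).
have sD (f : V -> 'rV[R]_n) j : smooth_fun U f ->
    smooth_fun U ('D_(delta_mx 0 i) (fun y => f y 0 j)).
  by move=> sf; apply: smooth_fun_derive; exact: sc.
have sg (f : V -> 'rV[R]_n) j : (forall x, U x -> O (f x)) -> smooth_fun U f ->
    smooth_fun U (g f j).
  move=> UO sf; apply: smooth_funM => //; last exact: sD.
  exact: smooth_fun_comp_scalar UO sf (sDh j).
suff gg j : jeq k (g f1 j) (g f2 j).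
  have sg1 j : smooth_fun U (g f1 j) by exact: sg.
  have sg2 j : smooth_fun U (g f2 j) by exact: sg.
  by have [] := jeq_sum (index_enum 'I_n) oU U0 sg1 sg2 gg.
apply: (jeqM oU U0).
- exact: smooth_fun_comp_scalar UO1 sf1 (sDh j).
- exact: smooth_fun_comp_scalar UO2 sf2 (sDh j).
- exact: sD.
- exact: sD.
- by apply: IH => // s sk; apply: ff; exact: leqW.
- move=> s sk; rewrite -!iterD_rcons !(iterD_coord _ _ oU)// ff//.
  by rewrite size_rcons.
Qed.

Lemma iterD_comp n p k (U : set V) (O : set 'rV[R]_n)
    (f1 f2 : V -> 'rV[R]_n) (h : 'rV[R]_n -> 'rV[R]_p) :
  open U -> open O -> U 0 ->
  (forall x, U x -> O (f1 x)) -> (forall x, U x -> O (f2 x)) ->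
  smooth_fun U f1 -> smooth_fun U f2 -> smooth_fun O h ->
  (forall s, (size s <= k)%N -> iterD s f1 0 = iterD s f2 0) ->
  forall s, (size s <= k)%N -> iterD s (h \o f1) 0 = iterD s (h \o f2) 0.
Proof.
move=> oU oO U0 UO1 UO2 sf1 sf2 sh ff s sk; apply/rowP => j.
have s1 := smooth_fun_comp oU oO UO1 sf1 sh.
have s2 := smooth_fun_comp oU oO UO2 sf2 sh.
rewrite -(iterD_coord s j oU s1 U0) -(iterD_coord s j oU s2 U0).
move: sh => /(smooth_fun_rVP _ oO)/(_ j) shj.
exact: (iterD_comp_scalar oU U0 UO1 UO2 sf1 sf2 shj ff).
Qed.

End JetComp.

Section Prolongation.
Context {R : realType} {d n : nat} {G : lieGroupType R d}.
Context {M : smoothManifoldType R n}.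
Implicit Types phi psi chi : 'rV[R]_n -> M.

Lemma jet_eq_refl k phi : jet_eq k phi phi.
Proof. by []. Qed.

Lemma jet_eq_sym k phi psi : jet_eq k phi psi -> jet_eq k psi phi.
Proof.
move=> [e0 e]; split=> [//|c Mc]; rewrite -e0 => c0 s sk.
by rewrite e.
Qed.

Lemma jet_eq_trans k phi psi chi :
  jet_eq k phi psi -> jet_eq k psi chi -> jet_eq k phi chi.
Proof.
move=> [e0 e] [e0' e']; split=> [|c Mc c0 s sk]; first by rewrite e0.
by rewrite e// e'// -e0.
Qed.

Lemma jetP k phi psi : local_diffeo psi ->
  jet k phi = jet k psi <-> jet_eq k phi psi.
Proof.
move=> dpsi; split=> [E|E].
  have : jet k psi psi by split.
  by rewrite -E => -[].
apply/seteqP; split=> chi [dchi chiE]; split=> //.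
  exact: jet_eq_trans (jet_eq_sym E) chiE.
exact: jet_eq_trans E chiE.
Qed.

Lemma local_diffeo_chart phi (c : chart R n M) (Q : set M) :
  local_diffeo phi -> atlas M c -> open Q -> Q `<=` chart_dom c -> Q (phi 0) ->
  exists U : set 'rV[R]_n, [/\ open U, U 0, smooth_fun U (c \o phi) &
    forall x, U x -> Q (phi x)].
Proof.
move=> [U [V [psi [[oU U0 oV] UV VU [cphi sphi] _]]]] Mc oQ Qc Q0.
exists (U `&` phi @^-1` Q); split => //.
- exact: open_setI_preimage.
- apply: smooth_funS (sphi _ _ erefl Mc) => x [Ux Qx].
  by exists x => //; split; [split|exact: Qc].
- by move=> x [].
Qed.

Lemma jet_eq_act k (a : smoothAction G M) (g : G) phi psi :
  local_diffeo phi -> local_diffeo psi -> jet_eq k phi psi ->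
  jet_eq k (a g \o phi) (a g \o psi).
Proof.
move=> dphi dpsi [e0 E]; split=> [|e Me /= eg s sk]; first by rewrite /= e0.
have [c Mc c0] := @atlas_cover R n M (phi 0).
have chc := atlas_chart _ Mc; have che := atlas_chart _ Me.
have [_ _ cK _ _] := chc.
pose Q := chart_dom c `&` setT `&` a g @^-1` chart_dom e.
have oQ : open Q.
  apply: smooth_on_domain_open => //; first exact: openT.
  by move=> x _; exact: act_continuous.
have Qc : Q `<=` chart_dom c by move=> ? [[]].
have Q0 : Q (phi 0) by [].
have [U1 [oU1 U10 s1 UQ1]] := local_diffeo_chart dphi Mc oQ Qc Q0.
have [U2 [oU2 U20 s2 UQ2]] :
    exists U : set 'rV[R]_n, [/\ open U, U 0, smooth_fun U (c \o psi) &
    forall x, U x -> Q (psi x)].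
  by apply: local_diffeo_chart => //; rewrite -e0.
pose U := U1 `&` U2.
have oU : open U by exact: openI.
have U0 : U 0 by [].
pose h := e \o a g \o chart_inv c.
have hE (chi : 'rV[R]_n -> M) : (forall x, U x -> Q (chi x)) ->
    forall x, U x -> (e \o (a g \o chi)) x = (h \o (c \o chi)) x.
  by move=> UQ x /UQ/Qc cx; rewrite /h /= cK// inE.
have UQ1' x : U x -> Q (phi x) by move=> [/UQ1].
have UQ2' x : U x -> Q (psi x) by move=> [_ /UQ2].
rewrite (eq_iterD s (nearU oU U0 (hE _ UQ1'))).
rewrite (eq_iterD s (nearU oU U0 (hE _ UQ2'))).
apply: (@iterD_comp _ _ _ _ k U (c @` Q)) => //.
- exact: chart_image_open.
- by move=> x Ux; exists (phi x) => //; exact: UQ1'.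
- by move=> x Ux; exists (psi x) => //; exact: UQ2'.
- by apply: smooth_funS s1 => x [].
- by apply: smooth_funS s2 => x [].
- by have [_] := act_smooth1 a g; exact.
- by move=> s' sk'; exact: E.
Qed.

Lemma frame_eq k (j1 j2 : frame k M) : frame_jet j1 = frame_jet j2 -> j1 = j2.
Proof.
case: j1 j2 => [j1 p1] [j2 p2] /= E; case: _ / E p2 => p2.
by congr Frame; exact: Prop_irrelevance.
Qed.

Lemma frame_repr_eq k phi (h : local_diffeo phi) :
  jet_eq k phi (frame_repr (@frame_of R n k M phi h)).
Proof.
apply/jetP; first exact: frame_reprP.
by rewrite /frame_repr; case: cid2.
Qed.

(* g . j^k_0 phi = j^k_0 (g \o phi); prolongE shows that the result does not
   depend on the representative. *)
Definition prolong (k : nat) (a : smoothAction G M) (g : G) (j : frame k M) :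
    frame k M :=
  frame_of (act_local_diffeo a g (frame_reprP j)).

Lemma prolongE k (a : smoothAction G M) (g : G) phi (h : local_diffeo phi) :
  prolong a g (frame_of h : frame k M) = frame_of (act_local_diffeo a g h).
Proof.
apply: frame_eq => /=; apply/jetP; first exact: act_local_diffeo.
apply: jet_eq_act => //; first exact: frame_reprP.
exact/jet_eq_sym/frame_repr_eq.
Qed.

End Prolongation.

Arguments prolong {R d n G M} k a g j.

(* Main.v *)
From HB Require Import structures.
From mathcomp Require Import all_boot all_order all_algebra finmap.
From mathcomp Require Import all_classical all_reals all_analysis.
From mathcomp Require Import ring lra.
Require Import Defs.

Set Implicit Arguments.
Unset Strict Implicit.
Unset Printing Implicit Defensive.
Import Order.TTheory GRing.Theory Num.Theory.
Import numFieldNormedType.Exports.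
Local Open Scope classical_set_scope.
Local Open Scope ring_scope.

(** Properness passes to the frame bundle because the jets of g \o phi depend
    continuously on g and on the jet of phi, the projection to M is continuous
    and the frame bundle is Hausdorff.

    For freeness, let g fix a frame at x. Then g fixes x with derivative the
    identity, and properness makes the stabilizer of x compact, so that the
    powers of g are uniformly C^1-close to the identity near x. A point y that
    g moves would then drift to infinity along the orbit of g, so g is the
    identity near x. The interior of the fixed point set of g is therefore
    open, closed (its limit points are again fixed with identity derivative)
    and nonempty, hence contains the component of x, and g = 1 by component
    effectiveness. *)

(** * Smooth germs at 0, each defined on a neighborhood of its own *)

Definition smooth_germ {R : realType} {m : nat} {W : normedModType R}
    (f : 'rV[R]_m -> W) : Prop :=
  exists U : set 'rV[R]_m, [/\ open U, U 0 & smooth_fun U f].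

Section SmoothGerm.
Context {R : realType} {m : nat}.
Local Notation V := 'rV[R]_m.

Lemma smooth_germ2 (W W' : normedModType R) (f : V -> W) (g : V -> W') :
  smooth_germ f -> smooth_germ g ->
  exists U : set V, [/\ open U, U 0, smooth_fun U f & smooth_fun U g].
Proof.
move=> [U [oU U0 sf]] [U' [oU' U'0 sg]]; exists (U `&` U'); split=> //.
- exact: openI.
- by apply: smooth_funS sf => x [].
- by apply: smooth_funS sg => x [].
Qed.

Lemma smooth_germ_derive (W : normedModType R) (f : V -> W) i :
  smooth_germ f -> smooth_germ ('D_(delta_mx 0 i) f).
Proof.
by move=> [U [oU U0 sf]]; exists U; split=> //; exact: smooth_fun_derive.
Qed.

Lemma smooth_germD (f g : V -> R) :
  smooth_germ f -> smooth_germ g -> smooth_germ (f + g).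
Proof.
move=> sf sg; have [U [oU U0 {}sf {}sg]] := smooth_germ2 sf sg.
by exists U; split=> //; exact: smooth_funD.
Qed.

Lemma smooth_germM (f g : V -> R) :
  smooth_germ f -> smooth_germ g -> smooth_germ (f * g).
Proof.
move=> sf sg; have [U [oU U0 {}sf {}sg]] := smooth_germ2 sf sg.
by exists U; split=> //; exact: smooth_funM.
Qed.

Lemma smooth_germ0 : smooth_germ (0 : V -> R).
Proof.
exists setT; split=> //; first exact: openT.
move=> s x _; elim/last_ind: s => [|s i IH]; first exact: differentiable_cst.
rewrite iterD_rcons (_ : 'D__ _ = 0) //.
by apply/funext => y; rewrite derive_cst.
Qed.

Lemma smooth_germ_coord n (f : V -> 'rV[R]_n) j :
  smooth_germ f -> smooth_germ (fun y => f y 0 j).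
Proof.
by move=> [U [oU U0 /(smooth_fun_rVP _ oU) sf]]; exists U; split.
Qed.

Lemma smooth_germ_preimage (W : normedModType R) (f : V -> W) (O : set W) :
  smooth_germ f -> open O -> O (f 0) ->
  exists U : set V, [/\ open U, U 0, smooth_fun U f &
    forall x, U x -> O (f x)].
Proof.
move=> [U [oU U0 sf]] oO O0; exists (U `&` f @^-1` O); split=> //.
- apply: open_setI_preimage => // x; rewrite inE => Ux.
  by apply: differentiable_continuous; exact: (sf [::]).
- by apply: smooth_funS sf => x [].
- by move=> x [].
Qed.

Lemma smooth_germ_comp_scalar n (f : V -> 'rV[R]_n) (O : set 'rV[R]_n)
    (h : 'rV[R]_n -> R) :
  smooth_germ f -> open O -> O (f 0) -> smooth_fun O h ->
  smooth_germ (h \o f).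
Proof.
move=> sf oO O0 sh.
have [U [oU U0 {}sf UO]] := smooth_germ_preimage sf oO O0.
by exists U; split=> //; exact: smooth_fun_comp_scalar UO sf sh.
Qed.

End SmoothGerm.

(** * Convergence of jets at 0 along a filter *)

Definition jet_cvg {R : realType} {m : nat} {W : normedModType R} {T : Type}
    (F : set_system T) (k : nat) (f : T -> 'rV[R]_m -> W)
    (f0 : 'rV[R]_m -> W) : Prop :=
  forall s, (size s <= k)%N -> iterD s (f p) 0 @[p --> F] --> iterD s f0 0.

Section JetCvg.
Context {R : realType} {m : nat} {T : Type} (F : set_system T) {FF : Filter F}.
Local Notation V := 'rV[R]_m.

(** The innermost derivative is split off, so that induction on the order passes to first partial
    derivatives, where the product and chain rules apply. *)
Lemma jet_cvgS k (f : T -> V -> R) f0 : jet_cvg F k.+1 f f0 <->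
  f p 0 @[p --> F] --> f0 0 /\
  forall i, jet_cvg F k (fun p => 'D_(delta_mx 0 i) (f p))
                        ('D_(delta_mx 0 i) f0).
Proof.
split=> [H|[H0 H]].
  split; first exact: (H [::]).
  move=> i s sk; under eq_fun do rewrite -iterD_rcons.
  by rewrite -iterD_rcons; apply: H; rewrite size_rcons.
case/lastP => [//|s i]; rewrite size_rcons ltnS => sk.
by under eq_fun do rewrite iterD_rcons; rewrite iterD_rcons; exact: H.
Qed.

Lemma jet_cvgW k (f : T -> V -> R) f0 :
  jet_cvg F k.+1 f f0 -> jet_cvg F k f f0.
Proof. by move=> H s sk; apply: H; exact: leqW. Qed.

Lemma jet_cvg_near k (W : normedModType R) (f f' : T -> V -> W) f0 f0' :
  (\forall p \near F, \forall y \near (0 : V), f p y = f' p y) ->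
  (\forall y \near (0 : V), f0 y = f0' y) ->
  jet_cvg F k f' f0' -> jet_cvg F k f f0.
Proof.
move=> ff ff0 H s sk; rewrite (eq_iterD s ff0).
apply: cvg_trans (H s sk); apply: near_eq_cvg.
by apply: filterS ff => p pf; rewrite (eq_iterD s pf).
Qed.

Lemma iterD_add (U : set V) (f g : V -> R) s x : open U ->
  smooth_fun U f -> smooth_fun U g -> U x ->
  iterD s (f + g) x = iterD s f x + iterD s g x.
Proof.
move=> oU sf sg; elim: s x => [//|i s IH] x Ux /=.
rewrite -[RHS]deriveD; [|exact/diff_derivable/sf|exact/diff_derivable/sg].
by apply: near_eq_derive; exact: (nearU oU Ux).
Qed.

Lemma jet_cvgD k (f g : T -> V -> R) f0 g0 :
  (\forall p \near F, smooth_germ (f p)) ->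
  (\forall p \near F, smooth_germ (g p)) ->
  smooth_germ f0 -> smooth_germ g0 ->
  jet_cvg F k f f0 -> jet_cvg F k g g0 ->
  jet_cvg F k (fun p => f p + g p) (f0 + g0).
Proof.
move=> sf sg sf0 sg0 ff gg s sk.
have E (u v : V -> R) : smooth_germ u -> smooth_germ v ->
    iterD s (u + v) 0 = iterD s u 0 + iterD s v 0.
  move=> su sv; have [U [oU U0 {}su {}sv]] := smooth_germ2 su sv.
  exact: (iterD_add s oU).
rewrite E//; apply: cvg_trans (cvgD (ff s sk) (gg s sk)); apply: near_eq_cvg.
by near=> p; rewrite E//; near: p.
Unshelve. all: by end_near. Qed.

(** By the Leibniz rule, the first partial derivatives of the products are sums of products of germs
    whose jets converge to order one less. *)
Lemma jet_cvgM k (f g : T -> V -> R) f0 g0 :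
  (\forall p \near F, smooth_germ (f p)) ->
  (\forall p \near F, smooth_germ (g p)) ->
  smooth_germ f0 -> smooth_germ g0 ->
  jet_cvg F k f f0 -> jet_cvg F k g g0 ->
  jet_cvg F k (fun p => f p * g p) (f0 * g0).
Proof.
elim: k f g f0 g0 => [|k IH] f g f0 g0 sf sg sf0 sg0 ff gg.
  by move=> [|//] _; apply: cvgM; [exact: (ff [::])|exact: (gg [::])].
move: (ff) (gg) => /jet_cvgS[ff0 ff'] /jet_cvgS[gg0 gg'].
apply/jet_cvgS; split; first exact: cvgM.
move=> i.
have DM (u v : V -> R) : smooth_germ u -> smooth_germ v ->
    \forall y \near (0 : V), 'D_(delta_mx 0 i) (u * v) y =
    (u * 'D_(delta_mx 0 i) v + v * 'D_(delta_mx 0 i) u) y.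
  move=> su sv; have [U [oU U0 {}su {}sv]] := smooth_germ2 su sv.
  apply: (nearU oU U0) => x Ux; rewrite deriveM//; apply: diff_derivable.
    exact: (su [::]).
  exact: (sv [::]).
have sD (u : T -> V -> R) : (\forall p \near F, smooth_germ (u p)) ->
    \forall p \near F, smooth_germ ('D_(delta_mx 0 i) (u p)).
  by apply: filterS => p; exact: smooth_germ_derive.
have sM (u v : T -> V -> R) : (\forall p \near F, smooth_germ (u p)) ->
    (\forall p \near F, smooth_germ (v p)) ->
    \forall p \near F, smooth_germ (u p * v p).
  by apply: filterS2 => p; exact: smooth_germM.
apply: (jet_cvg_near _ (DM _ _ sf0 sg0)
  (f' := fun p => f p * 'D_(delta_mx 0 i) (g p) +
                  g p * 'D_(delta_mx 0 i) (f p))).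
  by apply: filterS2 sf sg => p; exact: DM.
apply: jet_cvgD.
- by apply: sM => //; exact: sD.
- by apply: sM => //; exact: sD.
- by apply: smooth_germM => //; exact: smooth_germ_derive.
- by apply: smooth_germM => //; exact: smooth_germ_derive.
- by apply: IH => //; [exact: sD|exact: smooth_germ_derive|exact: jet_cvgW].
- by apply: IH => //; [exact: sD|exact: smooth_germ_derive|exact: jet_cvgW].
Qed.

Lemma jet_cvg_sum k (I : Type) (r : seq I) (f : I -> T -> V -> R) f0 :
  (forall i, \forall p \near F, smooth_germ (f i p)) ->
  (forall i, smooth_germ (f0 i)) ->
  (forall i, jet_cvg F k (f i) (f0 i)) ->
  jet_cvg F k (fun p => \sum_(i <- r) f i p) (\sum_(i <- r) f0 i).
Proof.
move=> sf sf0 ff.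
suff [_ _ //] : [/\ \forall p \near F, smooth_germ (\sum_(i <- r) f i p),
   smooth_germ (\sum_(i <- r) f0 i) &
   jet_cvg F k (fun p => \sum_(i <- r) f i p) (\sum_(i <- r) f0 i)].
elim: r => [|i r [IHf IHf0 IH]].
  rewrite big_nil; split; last first.
  - by under eq_fun do rewrite big_nil; move=> s _; exact: cvg_cst.
  - exact: smooth_germ0.
  by apply: nearW => p; rewrite big_nil; exact: smooth_germ0.
rewrite big_cons; split.
- by apply: filterS2 (sf i) IHf => p; rewrite big_cons; exact: smooth_germD.
- exact: smooth_germD.
- by under eq_fun do rewrite big_cons; exact: jet_cvgD.
Qed.

Lemma jet_cvg_coord n k (u : T -> V -> 'rV[R]_n) (u0 : V -> 'rV[R]_n) j :
  (\forall p \near F, smooth_germ (u p)) -> smooth_germ u0 ->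
  jet_cvg F k u u0 ->
  jet_cvg F k (fun p y => u p y 0 j) (fun y => u0 y 0 j).
Proof.
move=> su su0 uu s sk.
have E (v : V -> 'rV[R]_n) : smooth_germ v ->
    iterD s (fun y => v y 0 j) 0 = iterD s v 0 0 j.
  by move=> [U [oU U0 sv]]; rewrite (iterD_coord _ _ oU).
rewrite E//.
apply: (@cvg_trans _ ((fun x : 'rV[R]_n => x 0 j) @
    (iterD s (u p) 0 @[p --> F]))).
  by apply: near_eq_cvg; apply: filterS su => p pu; rewrite /= E.
apply: (@cvg_comp _ _ _ (fun p => iterD s (u p) 0) (fun x : 'rV[R]_n => x 0 j) _ _ _ (uu s sk)).
exact: coord_continuous.
Qed.

(** Induction on the order, for all [h] at once: the chain rule brings in the partial derivatives of
    [h] composed with [u p], and these are again smooth on [O]. *)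
Lemma jet_cvg_comp_scalar n k (u : T -> V -> 'rV[R]_n) (u0 : V -> 'rV[R]_n)
    (O : set 'rV[R]_n) (h : 'rV[R]_n -> R) : open O -> smooth_fun O h ->
  (\forall p \near F, smooth_germ (u p) /\ O (u p 0)) ->
  smooth_germ u0 -> O (u0 0) ->
  jet_cvg F k u u0 -> jet_cvg F k (fun p => h \o u p) (h \o u0).
Proof.
move=> oO + su su0 O0.
have cch (g : 'rV[R]_n -> R) : smooth_fun O g ->
    u p 0 @[p --> F] --> u0 0 -> (g \o u p) 0 @[p --> F] --> (g \o u0) 0.
  move=> sg uu; apply: (@cvg_comp _ _ _ (fun p => u p 0) g _ _ _ uu).
  have : differentiable g (u0 0) by exact: (sg [::]).
  exact: differentiable_continuous.
elim: k h => [|k IH] h sh uu.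
  by move=> [|//] _; apply: cch => //; exact: (uu [::]).
apply/jet_cvgS; split=> [|i]; first by apply: cch => //; exact: (uu [::]).
have cS (v : V -> 'rV[R]_n) : smooth_germ v -> O (v 0) ->
    \forall y \near (0 : V), 'D_(delta_mx 0 i) (h \o v) y =
    (\sum_(j < n) (('D_(delta_mx 0 j) h \o v) *
                   'D_(delta_mx 0 i) (fun y => v y 0 j))) y.
  move=> sv Ov; have [U [oU U0 {}sv UO]] := smooth_germ_preimage sv oO Ov.
  apply: (nearU oU U0) => x Ux; rewrite fct_sumE.
  by rewrite derive_comp_rV; [|exact: (sv [::])|exact: (sh [::] _ (UO _ Ux))].
have su' : \forall p \near F, smooth_germ (u p) by apply: filterS su => p [].
apply: (jet_cvg_near _ (cS _ su0 O0) (f' := fun p =>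
    \sum_(j < n) (('D_(delta_mx 0 j) h \o u p) *
                   'D_(delta_mx 0 i) (fun y => u p y 0 j)))).
  by apply: filterS su => p [su Ou]; exact: cS.
have sDc j (v : V -> 'rV[R]_n) : smooth_germ v ->
    smooth_germ ('D_(delta_mx 0 i) (fun y => v y 0 j)).
  by move=> sv; apply: smooth_germ_derive; exact: smooth_germ_coord.
have sDh j (v : V -> 'rV[R]_n) : smooth_germ v -> O (v 0) ->
    smooth_germ ('D_(delta_mx 0 j) h \o v).
  by move=> sv Ov; apply: smooth_germ_comp_scalar sv oO Ov _;
    exact: smooth_fun_derive.
apply: jet_cvg_sum => j.
- by apply: filterS su => p [su Ou]; apply: smooth_germM; [exact: sDh|exact: sDc].
- by apply: smooth_germM; [exact: sDh|exact: sDc].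
- apply: jet_cvgM.
  + by apply: filterS su => p [su Ou]; exact: sDh.
  + by apply: filterS su' => p; exact: sDc.
  + exact: sDh.
  + exact: sDc.
  + by apply: IH; [exact: smooth_fun_derive|move=> s sk; apply: uu; exact: leqW].
  + by have /jet_cvgS[_] := jet_cvg_coord (j := j) su' su0 uu; exact.
Qed.

Lemma cvg_rV n (x : T -> 'rV[R]_n) (x0 : 'rV[R]_n) :
  (forall j, x p 0 j @[p --> F] --> x0 0 j) -> x p @[p --> F] --> x0.
Proof.
move=> cx A [P nP PA].
have : \forall p \near F, forall j, P 0 j (x p 0 j).
  by apply: filter_forall => j; exact: (cx j _ (nP 0 j)).
by apply: filterS => y Py; apply: PA => i j; rewrite ord1.
Qed.

Lemma jet_cvg_comp n q k (u : T -> V -> 'rV[R]_n) (u0 : V -> 'rV[R]_n)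
    (O : set 'rV[R]_n) (h : 'rV[R]_n -> 'rV[R]_q) : open O -> smooth_fun O h ->
  (\forall p \near F, smooth_germ (u p) /\ O (u p 0)) ->
  smooth_germ u0 -> O (u0 0) ->
  jet_cvg F k u u0 -> jet_cvg F k (fun p => h \o u p) (h \o u0).
Proof.
move=> oO sh su su0 O0 uu s sk; apply: cvg_rV => j.
have E (v : V -> 'rV[R]_n) : smooth_germ v -> O (v 0) ->
    iterD s (h \o v) 0 0 j = iterD s ((fun z => h z 0 j) \o v) 0.
  move=> sv Ov; have [U [oU U0 {}sv UO]] := smooth_germ_preimage sv oO Ov.
  have shv := smooth_fun_comp oU oO UO sv sh.
  by rewrite -(iterD_coord s j oU shv U0).
have shj : smooth_fun O (fun z => h z 0 j) by have /(smooth_fun_rVP _ oO) := sh.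
rewrite E//; apply: cvg_trans (jet_cvg_comp_scalar oO shj su su0 O0 uu sk).
by apply: near_eq_cvg; apply: filterS su => p [su Ou]; rewrite E.
Qed.

End JetCvg.

(** * Ultrafilters and the topology of the frame bundle *)

Lemma ultra_fmap (T U : Type) (f : T -> U) (F : set_system T) :
  UltraFilter F -> UltraFilter (f @ F).
Proof.
move=> UF; have PF : ProperFilter (f @ F) by exact: fmap_proper_filter.
split=> // H PH FH; apply/seteqP; split=> // A HA.
have [//|FC] := in_ultra_setVsetC (f @^-1` A) UF.
have /FH HC : (f @ F) (~` A) by [].
by case: (filter_not_empty H); rewrite -(setICr A); exact: filterI.
Qed.

Section FrameTopology.
Context {R : realType} {n k : nat} {M : smoothManifoldType R n}.
Implicit Types (j : frame k M) (c : chart R n M).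

Lemma frame_subbase_open (B : set (frame k M)) : frame_subbase B -> open B.
Proof.
move=> sB; exists [set B]; last by rewrite bigcup_set1.
move=> _ ->; exists [fset B]%fset; first by move=> C /fset1P ->; rewrite inE.
apply/seteqP; split=> [x xB|x Bx C]; last by rewrite /= inE => /eqP ->.
by apply: (xB B); rewrite /= inE.
Qed.

(** Each neighborhood of [j] contains a finite intersection of subbasic sets around [j], and a
    filter is stable under finite intersections. *)
Lemma cvg_frame (T : Type) (F : set_system T) {FF : Filter F}
    (f : T -> frame k M) j :
  (forall B, frame_subbase B -> B j -> \forall p \near F, B (f p)) ->
  f p @[p --> F] --> j.
Proof.
move=> FB A; rewrite nbhsE => -[_ [[D' D'D <-] [B D'B Bj]] OA].
have [D DS BE] := D'D _ D'B.
apply: (@filterS _ _ _ (\bigcap_(i in [set` D]) (f @^-1` i))).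
  move=> p Dp; apply: OA; exists B => //.
  have : (B : set (frame k M)) (f p) by rewrite -BE => i; exact: Dp.
  exact.
apply: filter_bigI => C DC; apply: FB; first by have := DS _ DC; rewrite inE.
have {Bj} : (B : set (frame k M)) j by exact: Bj.
by rewrite -BE => /(_ C DC).
Qed.

Lemma frame_jetE j : frame_jet j = jet k (frame_repr j).
Proof. by rewrite /frame_repr; case: cid2. Qed.

Lemma frame_ext j1 j2 : jet_eq k (frame_repr j1) (frame_repr j2) -> j1 = j2.
Proof.
move=> E; apply: frame_eq; rewrite !frame_jetE.
by apply/(jetP _ _ (frame_reprP j2)).
Qed.

Lemma frame_chart_near c j : atlas M c -> chart_dom c (frame_repr j 0) ->
  \forall j' \near j, chart_dom c (frame_repr j' 0).
Proof.
move=> Mc cj; apply: open_nbhs_nbhs; split=> //; apply: frame_subbase_open.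
exists c, [::], setT; split=> //; first exact: openT.
by apply/seteqP; split=> [j' ?|j' []].
Qed.

Lemma frame_jet_cvg c j : atlas M c -> chart_dom c (frame_repr j 0) ->
  jet_cvg (nbhs j) k (fun j' => c \o frame_repr j') (c \o frame_repr j).
Proof.
move=> Mc cj s sk A; rewrite nbhsE => -[ O [oO Oj] OA].
have : nbhs j [set j' | chart_dom c (frame_repr j' 0) /\
                     O (iterD s (c \o frame_repr j') 0)].
  apply: open_nbhs_nbhs; split=> //; apply: frame_subbase_open.
  by exists c, s, O.
by apply: filterS => j' [_ ?]; exact: OA.
Qed.

Lemma frame_proj_continuous : continuous (fun j => frame_repr j 0).
Proof.
move=> j A; rewrite nbhsE => -[ O [oO Oj] OA].
have [c Mc cj] := @atlas_cover R n M (frame_repr j 0).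
have [oc _ cK _ _] := atlas_chart _ Mc.
have oI : open (c @` (chart_dom c `&` O)).
  apply: chart_image_open; [exact: atlas_chart|exact: openI|by move=> ? []].
(* The empty multi-index, admissible for every [k], gives the coordinates of the base point. *)
have := frame_jet_cvg Mc cj (leq0n k : (size [::] <= k)%N).
move=> /(_ (c @` (chart_dom c `&` O))) nI.
have {}nI := nI (open_nbhs_nbhs (conj oI (ex_intro2 _ _ _ (conj cj Oj) erefl))).
apply: filterS2 (frame_chart_near Mc cj) nI => j' cj' [x [cx Ox] /= cE].
apply: OA; suff <- : x = frame_repr j' 0 by [].
by rewrite -[LHS]cK ?inE// cE cK ?inE.
Qed.

Lemma frame_smooth_germ c j : atlas M c -> chart_dom c (frame_repr j 0) ->
  smooth_germ (c \o frame_repr j).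
Proof.
move=> Mc cj; have [oc _ _ _ _] := atlas_chart _ Mc.
have [U [oU U0 sU _]] :=
  local_diffeo_chart (frame_reprP j) Mc oc (@subset_refl _ _) cj.
by exists U.
Qed.

(** The base point and the derivatives in a chart depend continuously on the frame and take values
    in Hausdorff spaces, so they agree on two frames that cannot be separated; they determine the
    frame. *)
Lemma frame_hausdorff : hausdorff_space (frame k M).
Proof.
move=> j1 j2 cl; apply: frame_ext.
have E0 : frame_repr j1 0 = frame_repr j2 0.
  apply: (@manifold_hausdorff R n M) => A B nA nB.
  have [j [Aj Bj]] := cl _ _ (frame_proj_continuous nA)
    (frame_proj_continuous nB).
  by exists (frame_repr j 0).
split=> // c Mc c1 s sk; have c2 := c1; rewrite E0 in c2.
apply: (@norm_hausdorff _ 'rV[R]_n) => A B nA nB.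
have [j [Aj Bj]] := cl _ _ (frame_jet_cvg Mc c1 sk nA)
    (frame_jet_cvg Mc c2 sk nB).
by exists (iterD s (c \o frame_repr j) 0).
Qed.

End FrameTopology.

(** * Continuity and properness of the prolonged action *)

Section ProlongProper.
Context {R : realType} {d n : nat} {G : lieGroupType R d}.
Context {M : smoothManifoldType R n}.
Variable a : smoothAction G M.

(** The representative chosen for the prolonged frame need not be [a g \o frame_repr j], but it has
    the same jet, which is all that the subbasic sets see. *)
Lemma frame_repr_prolong k (g : G) (j : frame k M) :
  jet_eq k (a g \o frame_repr j) (frame_repr (prolong k a g j)).
Proof. exact: frame_repr_eq. Qed.

Lemma iterD_cst m (b : R) (s : seq 'I_m) :
  iterD s (cst b) = cst (if s is [::] then b else 0) :> ('rV[R]_m -> R).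
Proof.
elim: s => [//|i s IH] /=; rewrite IH.
by apply/funext => y; rewrite derive_cst.
Qed.

Lemma smooth_fun_row_mx m (U : set 'rV[R]_m) (z0 : 'rV[R]_d)
    (f : 'rV[R]_m -> 'rV[R]_n) : open U -> smooth_fun U f ->
  smooth_fun U (fun z => row_mx z0 (f z)).
Proof.
move=> oU sf; apply/(smooth_fun_rVP _ oU) => j.
case: (split_ordP j) => i ->; last first.
  under eq_fun do rewrite row_mxEr.
  by move: sf => /(smooth_fun_rVP _ oU) /(_ i).
under eq_fun do rewrite row_mxEl.
move=> s x _; rewrite -[fun=> _]/(cst _) iterD_cst.
exact: differentiable_cst.
Qed.

(** The block [z p] is constant in [y]: its derivatives of positive order vanish, and only its value
    has to converge. *)
Lemma jet_cvg_row_mx m k (T : Type) (F : set_system T) {FF : Filter F}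
    (z : T -> 'rV[R]_d) (z0 : 'rV[R]_d)
    (f : T -> 'rV[R]_m -> 'rV[R]_n) (f0 : 'rV[R]_m -> 'rV[R]_n) :
  (\forall p \near F, smooth_germ (f p)) -> smooth_germ f0 ->
  z p @[p --> F] --> z0 -> jet_cvg F k f f0 ->
  jet_cvg F k (fun p y => row_mx (z p) (f p y)) (fun y => row_mx z0 (f0 y)).
Proof.
move=> sf sf0 zz ff s sk; apply: cvg_rV => j.
have E (w : 'rV[R]_d) (g : 'rV[R]_m -> 'rV[R]_n) : smooth_germ g ->
    iterD s (fun y => row_mx w (g y)) 0 0 j =
    iterD s (fun y => row_mx w (g y) 0 j) 0.
  move=> [U [oU U0 sg]].
  by rewrite (iterD_coord s j oU (smooth_fun_row_mx w oU sg) U0).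
rewrite E//.
apply: (@cvg_trans _ (iterD s (fun y => row_mx (z p) (f p y) 0 j) 0 @[p --> F])).
  by apply: near_eq_cvg; apply: filterS sf => p pf; rewrite E.
case: (split_ordP j) => i ->; last first.
  have Er (w : 'rV[R]_d) (g : 'rV[R]_m -> 'rV[R]_n) :
      (fun y => row_mx w (g y) 0 (rshift d i)) = (fun y => g y 0 i).
    by apply/funext => y; rewrite row_mxEr.
  under eq_fun do rewrite Er.
  by rewrite Er; exact: (jet_cvg_coord (j := i) sf sf0 ff).
have El (w : 'rV[R]_d) (g : 'rV[R]_m -> 'rV[R]_n) :
    (fun y => row_mx w (g y) 0 (lshift n i)) = cst (w 0 i).
  by apply/funext => y; rewrite row_mxEl.
under eq_fun do rewrite El iterD_cst.
rewrite El iterD_cst.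
case: s {E sk} => [|_ _]; last exact: cvg_cst.
apply: (@cvg_comp _ _ _ z (fun x : 'rV[R]_d => x 0 i) _ _ _ zz).
exact: coord_continuous.
Qed.

(** In charts, moving a frame by a group element is composition of the fixed smooth map [h] with the
    germ [u p], in which the group element is a constant block. Jets of [u p] converge, hence so do
    those of [h \o u p]. *)
Lemma prolong_continuous k :
  continuous (fun p : G * frame k M => prolong k a p.1 p.2).
Proof.
move=> [g0 j0]; apply: cvg_frame => B [e [s [ O [Me sk oO ->]]]] /=.
set x0 := frame_repr j0 0.
have rE g j := @frame_repr_prolong k g j.
have [/= r00 r0] := rE g0 j0; move=> [er0]; rewrite -r00 in er0.
rewrite -r0// => Or0.
have [c0 Gc0 c0g] := @atlas_cover R d G g0.
have [c Mc cx] := @atlas_cover R n M x0.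
have chc0 := atlas_chart _ Gc0; have chc := atlas_chart _ Mc.
have che := atlas_chart _ Me.
have [oc0 _ c0K cc0 _] := chc0; have [oc _ cK _ _] := chc.
have [oe _ _ _ _] := che.
have [ca sa] := act_smooth a.
pose A := fun p : G * M => a p.1 p.2.
pose Q := chart_dom (prod_chart c0 c) `&` setT `&` A @^-1` chart_dom e.
have oQ : open Q.
  apply: smooth_on_domain_open => //; [exact: prod_is_chart|exact: openT].
pose P := prod_chart c0 c @` Q.
have oP : open P.
  by apply: chart_image_open => //; [exact: prod_is_chart|move=> ? [[]]].
pose h := e \o A \o chart_inv (prod_chart c0 c).
have sh : smooth_fun P h by apply: sa => //; exists c0, c.
pose u (p : G * frame k M) y := row_mx (c0 p.1) ((c \o frame_repr p.2) y).
have Q0 : Q (g0, x0) by [].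
have nQ : \forall p \near (g0, j0), Q (p.1, frame_repr p.2 0).
  have : (fun p : G * frame k M => (p.1, frame_repr p.2 0)) @ (g0, j0) -->
      (g0, x0).
    apply: cvg_pair; first exact: cvg_fst.
    apply: (@cvg_comp _ _ _ snd (fun j : frame k M => frame_repr j 0)
      _ (nbhs j0)); first exact: cvg_snd.
    exact: frame_proj_continuous.
  by apply; exact: open_nbhs_nbhs.
have hE p : Q (p.1, frame_repr p.2 0) ->
    \forall y \near (0 : 'rV[R]_n),
      (e \o (a p.1 \o frame_repr p.2)) y = (h \o u p) y.
  move=> [[[/= c0p cp] _] _].
  have [U [oU U0 _ Uc]] :=
    local_diffeo_chart (frame_reprP p.2) Mc oc (@subset_refl _ _) cp.
  apply: (nearU oU U0) => y /Uc cy.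
  by rewrite /h /u /A /= row_mxKl row_mxKr c0K ?cK// inE.
have su p : Q (p.1, frame_repr p.2 0) -> smooth_germ (u p) /\ P (u p 0).
  move=> Qp; split; last by exists (p.1, frame_repr p.2 0).
  case: Qp => [[[/= c0p cp] _] _].
  have [U [oU U0 sU]] := frame_smooth_germ Mc cp.
  by exists U; split=> //; exact: smooth_fun_row_mx.
have [su0 Pu0] := su (g0, j0) Q0.
have ju : jet_cvg (nbhs (g0, j0)) k u (u (g0, j0)).
  apply: jet_cvg_row_mx.
  - apply: filterS nQ => p [[[/= c0p cp] _] _]; exact: frame_smooth_germ.
  - exact: frame_smooth_germ.
  - apply: (@cvg_comp _ _ _ fst c0 _ (nbhs g0)); first exact: cvg_fst.
    by apply: cc0; rewrite inE.
  - move=> s' sk'.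
    apply: (@cvg_comp _ _ _ snd (fun j : frame k M =>
      iterD s' (c \o frame_repr j) 0) _ (nbhs j0)); first exact: cvg_snd.
    exact: frame_jet_cvg.
have su' : \forall p \near (g0, j0), smooth_germ (u p) /\ P (u p 0).
  by apply: filterS nQ => p; exact: su.
have js := @jet_cvg_comp _ _ _ _ _ _ _ _ _ _ _ _ oP sh su' su0 Pu0 ju s sk.
have nO : \forall p \near (g0, j0), O (iterD s (h \o u p) 0).
  apply: js; apply: open_nbhs_nbhs; split=> //.
  by move: Or0; rewrite -(eq_iterD s (hE (g0, j0) Q0)).
apply: filterS2 nQ nO => p Qp; rewrite -(eq_iterD s (hE p Qp)) => Op.
have [/= rp0 rp] := rE p.1 p.2.
have ep : chart_dom e (a p.1 (frame_repr p.2 0)) by case: Qp.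
by rewrite -rp0 -rp.
Qed.

(** Compactness is tested on an ultrafilter [F]. Its frame component converges because its image in
    [K] does; its group component converges by properness of the action on [M], applied to the base
    points. *)
Lemma prolong_proper k : proper_action a -> proper_action (prolong k a).
Proof.
move=> [_ pa]; have cf : continuous (fun p : G * frame k M =>
    (prolong k a p.1 p.2, p.2)).
  move=> p; have c2 : q.2 @[q --> p] --> p.2 by exact: cvg_snd.
  exact: (cvg_pair (@prolong_continuous k p) c2).
split=> // K cK; rewrite compact_ultra => F UF FK.
have PF : ProperFilter F by exact: ultra_proper.
pose pi (j : frame k M) : M := frame_repr j 0.
pose K' := (fun q : frame k M * frame k M => (pi q.1, pi q.2)) @` K.
have cK' : compact K'.
  apply: continuous_compact => //; apply: continuous_subspaceT => q.
  have c1 : pi p.1 @[p --> q] --> pi q.1.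
    apply: (@cvg_comp _ _ _ fst pi _ (nbhs q.1)); first exact: cvg_fst.
    exact: frame_proj_continuous.
  have c2 : pi p.2 @[p --> q] --> pi q.2.
    apply: (@cvg_comp _ _ _ snd pi _ (nbhs q.2)); first exact: cvg_snd.
    exact: frame_proj_continuous.
  exact: (cvg_pair c1 c2).
pose f (p : G * frame k M) := (prolong k a p.1 p.2, p.2).
pose f' (p : G * frame k M) := (p.1, pi p.2).
(* The limit [j2] of the frames comes from [K] itself. *)
have := cK; rewrite compact_ultra => /(_ (f @ F) (ultra_fmap _ _) FK).
move=> [[j1 j2] [Kj Fj]].
have FQ : (f' @ F) ((fun p : G * M => (a p.1 p.2, p.2)) @^-1` K').
  apply: (@filterS _ F _ _ _ _ FK) => p Kp; exists (f p) => //.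
  by rewrite /f /pi /=; have [<-] := frame_repr_prolong p.1 p.2.
(* Below, only the component [g] of this limit is kept, the frames having their own limit. *)
have := pa _ cK'; rewrite compact_ultra => /(_ (f' @ F) (ultra_fmap _ _) FQ).
move=> [[g x] [_ Fg]].
have F1 : p.1 @[p --> F] --> g.
  by apply: (@cvg_comp _ _ _ f' fst _ _ _ Fg); exact: cvg_fst.
have F2 : p.2 @[p --> F] --> j2.
  by apply: (@cvg_comp _ _ _ f snd _ _ _ Fj); exact: cvg_snd.
have FF : F --> (g, j2).
  move=> A nA; have FA : F [set p | A (p.1, p.2)] by exact: (cvg_pair F1 F2 nA).
  by apply: (@filterS _ F _ _ _ _ FA) => -[].
exists (g, j2); split=> //=.
(* Both are limits of the moved frames, one by continuity of the prolonged action and one by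
   convergence in [K]. *)
suff -> : prolong k a g j2 = j1 by [].
apply: (@cvg_unique _ (@frame_hausdorff _ _ _ M)
  ((fun p => prolong k a p.1 p.2) @ F)).
  by apply: cvg_trans (cvg_app _ FF) (@prolong_continuous k (g, j2)).
by apply: (@cvg_comp _ _ _ f fst _ _ _ Fj); exact: cvg_fst.
Qed.

End ProlongProper.

(** * A mean value inequality and a bound on drift *)

Section MeanValue.
Context {R : realType} {m : nat}.
Local Notation V := 'rV[R]_m.

Lemma is_derive_line (W : normedModType R) (f : V -> W) (z w : V) (t : R) :
  derivable f (z + t *: w) w ->
  is_derive t 1 (fun u : R => f (z + u *: w)) ('D_w f (z + t *: w)).
Proof.
have E : (fun h : R => h^-1 *: (((fun u : R => f (z + u *: w)) \o shift t)
      (h *: (1 : R)) - f (z + t *: w))) =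
    (fun h => h^-1 *: ((f \o shift (z + t *: w)) (h *: w) - f (z + t *: w))).
  apply/funext => h /=; congr (_ *: (f _ - _)).
  by rewrite scalerDl addrCA [h *: 1]mulr1.
move=> df; split; rewrite /derivable /derive E //.
Qed.

Lemma derive_delta_sum (W : normedModType R) (f : V -> W) (x w : V) :
  differentiable f x -> 'D_w f x = \sum_(i < m) w 0 i *: 'D_(delta_mx 0 i) f x.
Proof.
move=> df; rewrite deriveE// {1}[w]row_sum_delta linear_sum.
by apply: eq_bigr => i _; rewrite linearZ /= deriveE.
Qed.

Lemma derive_comp (U W X : normedModType R) (f : U -> W) (g : W -> X)
    (x v : U) : differentiable f x -> differentiable g (f x) ->
  'D_v (g \o f) x = 'D_('D_v f x) g (f x).
Proof.
move=> df dg; rewrite (deriveE _ (differentiable_comp df dg)).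
by rewrite (deriveE _ dg) (deriveE _ df) (diff_comp df dg).
Qed.

Lemma rV_norm_le n (x : 'rV[R]_n) (e : R) :
  0 <= e -> (forall i, `|x 0 i| <= e) -> `|x| <= e.
Proof.
move=> e0 xe; rewrite [X in X <= _]/Num.norm /= mx_normrE; apply/bigmax_leP.
by split=> // -[i j] _; rewrite /= ord1.
Qed.

Lemma rV_norm_ge n (x : 'rV[R]_n) i : `|x 0 i| <= `|x|.
Proof.
rewrite [X in _ <= X]/Num.norm /= mx_normrE.
by apply/bigmax_geP; right => /=; exists (0, i).
Qed.

(** Each coordinate of [f] obeys the one-variable mean value theorem on the segment from [z] to [y],
    which the convex ball contains. The factor [m] counts the partial derivatives; the norm is the
    maximum norm. *)
Lemma mean_value_ineq n (f : V -> 'rV[R]_n) (y0 : V) (r e : R) : 0 <= e ->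
  (forall y, ball y0 r y -> differentiable f y /\
     forall i, `|'D_(delta_mx 0 i) f y| <= e) ->
  forall y z, ball y0 r y -> ball y0 r z -> `|f y - f z| <= m%:R * e * `|y - z|.
Proof.
move=> e0 Hf y z By Bz; set w := y - z.
have Bt (t : R) : 0 <= t <= 1 -> ball y0 r (z + t *: w).
  move=> /andP[t0 t1]; move: By Bz; rewrite -!ball_normE /ball_ /= => By Bz.
  have -> : y0 - (z + t *: w) = t *: (y0 - y) + (1 - t) *: (y0 - z).
    by apply/rowP => i; rewrite !mxE; ring.
  apply: le_lt_trans (ler_normD _ _) _; rewrite !normrZ.
  rewrite (ger0_norm t0) (ger0_norm (_ : 0 <= 1 - t)) ?subr_ge0//.
  (* Strictness is drawn from the term in [y], which disappears at [t = 0]; there the point is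
     [z]. *)
  have [->|t0'] := eqVneq t 0; first by rewrite mul0r add0r subr0 mul1r.
  have -> : r = t * r + (1 - t) * r by rewrite -mulrDl addrC subrK mul1r.
  apply: ltr_leD; first by rewrite ltr_pM2l// lt_def t0'.
  by apply: ler_wpM2l; [rewrite subr_ge0|exact: ltW].
apply: rV_norm_le => [|j]; first by rewrite !mulr_ge0.
pose k (t : R) : R := f (z + t *: w) 0 j.
have dk (t : R) : 0 <= t <= 1 ->
    is_derive t 1 k ('D_w (fun p => f p 0 j) (z + t *: w)).
  move=> /Bt/Hf[df _].
  have /diff_derivable dfj : differentiable (fun p => f p 0 j) (z + t *: w).
    by have /differentiable_rVP := df.
  exact: (@is_derive_line _ (fun p => f p 0 j : R)).
have dk' (t : R) : t \in `]0, 1[ ->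
    is_derive t 1 k ('D_w (fun p => f p 0 j) (z + t *: w)).
  by rewrite in_itv /= => /andP[/ltW t0 /ltW t1]; apply: dk; rewrite t0.
have [|t] := MVT ltr01 dk'.
  apply: derivable_within_continuous => t; rewrite in_itv /= => /dk dt.
  exact: ex_derive.
rewrite in_itv /= => /andP[/ltW t0 /ltW t1].
have /Bt/Hf[df Df] : 0 <= t <= 1 by rewrite t0.
rewrite subr0 mulr1 derive_coord// derive_delta_sum//.
rewrite /k scale1r scale0r addr0 /w [z + _]addrC subrK => E.
rewrite 2!mxE E summxE.
apply: le_trans (ler_norm_sum _ _ _) _.
apply: (@le_trans _ _ (\sum_(i < m) e * `|y - z|)).
  apply: ler_sum => i _; rewrite [X in `|X|]mxE normrM mulrC.
  by apply: ler_pM => //; [apply: le_trans (Df i)|]; exact: rV_norm_ge.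
by rewrite sumr_const card_ord -[e * _ *+ _]mulr_natl mulrA.
Qed.

End MeanValue.

(** After [k] steps the displacement differs from [w *+ k] by at most half the norm of the latter,
    so it grows at least like half of [k] times the norm of [w]. *)
Lemma bounded_drift_eq0 (R : realType) (V : normedModType R) (v : nat -> V)
    (w : V) (B : R) :
  (forall k, `|v k.+1 - v k - w| <= 2^-1 * `|w|) ->
  (forall k, `|v k - v 0%N| <= B) -> w = 0.
Proof.
move=> vw vB.
have vk k : `|v k - v 0%N - w *+ k| <= k%:R * (2^-1 * `|w|).
  elim: k => [|k IH]; first by rewrite subrr subr0 normr0 mul0r.
  have -> : v k.+1 - v 0%N - w *+ k.+1 =
      (v k.+1 - v k - w) + (v k - v 0%N - w *+ k).
    rewrite [in RHS]addrACA [v k.+1 - v k + _]addrA subrK.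
    by rewrite mulrSr -opprD [w + _]addrC.
  apply: le_trans (ler_normD _ _) _.
  by rewrite -natr1 mulrDl mul1r addrC; exact: lerD.
apply/eqP; rewrite -normr_eq0; apply: contraT => w0.
have {}w0 : 0 < `|w| by rewrite lt_def w0 /=.
(* For [k] beyond twice [B] over the norm of [w], the displacement would exceed [B]. *)
pose k := (Num.bound (B / `|w| * 2)).
have Bk : B / `|w| * 2 < k%:R.
  apply: archi_boundP; rewrite mulr_ge0// divr_ge0//.
  exact: le_trans (normr_ge0 _) (vB 0%N).
have : `|w *+ k| <= B + k%:R * (2^-1 * `|w|).
  have -> : w *+ k = (v k - v 0%N) - (v k - v 0%N - w *+ k).
    by rewrite opprB addrCA subrr addr0.
  by apply: le_trans (ler_normB _ _) _; exact: lerD.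
rewrite normrMn -mulr_natl => wk.
suff : k%:R <= B / `|w| * 2 by rewrite leNgt Bk.
rewrite mulrAC ler_pdivlMr//; lra.
Qed.

(** * The action read in a chart, near a fixed point *)

Section ChartedAction.
Context {R : realType} {d n : nat} {G : lieGroupType R d}.
Context {M : smoothManifoldType R n}.
Variables (a : smoothAction G M) (c : chart R n M).
Hypothesis Mc : atlas M c.
Local Notation D := (chart_dom c).

(** Only the values on [charted_dom h] are meaningful: elsewhere the point, or its image under [h],
    may leave the chart. *)
Definition charted_act (h : G) : 'rV[R]_n -> 'rV[R]_n :=
  c \o a h \o chart_inv c.
Local Notation F := charted_act.

Definition charted_dom (h : G) : set 'rV[R]_n := c @` (D `&` a h @^-1` D).

Let chc := atlas_chart _ Mc.

Lemma chartK x : D x -> chart_inv c (c x) = x.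
Proof. by move=> Dx; have [_ _ cK _ _] := chc; rewrite cK ?inE. Qed.

Lemma charted_actE h x : D x -> F h (c x) = c (a h x).
Proof. by move=> Dx; rewrite /F /= chartK. Qed.

Lemma charted_act_smooth h : smooth_fun (charted_dom h) (F h).
Proof.
have [_ sa] := act_smooth1 a h.
by apply: smooth_funS (sa c c Mc Mc); apply: image_subset => x [].
Qed.

Lemma charted_act_diff h x : D x -> D (a h x) -> differentiable (F h) (c x).
Proof. by move=> Dx Dhx; apply: (@charted_act_smooth h [::]); exists x. Qed.

Lemma chart_near x (P : set M) : D x -> nbhs x P ->
  \forall y \near c x, exists2 p, D p /\ P p & c p = y.
Proof.
move=> Dx; rewrite nbhsE => -[ O [oO Ox] OP].
have [oD _ _ _ _] := chc.
have oI : open (c @` (D `&` O)).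
  by apply: chart_image_open => //; exact: openI.
apply: filterS (open_nbhs_nbhs (conj oI (ex_intro2 _ _ x (conj Dx Ox) erefl))).
by move=> y [p [Dp Op] <-]; exists p => //; split => //; exact: OP.
Qed.

Lemma near_chart x (P : set 'rV[R]_n) : D x -> nbhs (c x) P ->
  \forall p \near x, D p /\ P (c p).
Proof.
move=> Dx nP; have [oD _ _ cc _] := chc.
apply: filterI; first by apply: open_nbhs_nbhs.
by have := cc x; rewrite inE => /(_ Dx); exact.
Qed.

Lemma charted_dom_near (h0 : G) x : D x -> D (a h0 x) ->
  \forall q \near (h0, c x), charted_dom q.1 q.2.
Proof.
move=> Dx Dhx; have [ca _] := act_smooth a; have [oD _ _ _ _] := chc.
have [[A B] /= [nA nB] AB] : \forall q \near (h0, x), D (a q.1 q.2).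
  by apply: (ca (h0, x) (in_setT _)); exact: open_nbhs_nbhs.
exists (A, [set y | exists2 p, D p /\ B p & c p = y]).
  by split=> //=; exact: chart_near.
move=> [h y] /= [Ah [p [Dp Bp] <-]]; exists p => //; split=> //.
exact: (AB (h, p)).
Qed.

(** Continuity is joint in the group element and the point, because this is a partial derivative,
    along a direction of [M], of the smooth map of both variables. *)
Lemma charted_act_derive_cvg (h0 : G) x i : D x -> D (a h0 x) ->
  'D_(delta_mx 0 i) (F q.1) q.2 @[q --> (h0, c x)] -->
  'D_(delta_mx 0 i) (F h0) (c x).
Proof.
move=> Dx Dhx; have [_ sa] := act_smooth a.
have [c0 Gc0 c0h] := @atlas_cover R d G h0.
have chc0 := atlas_chart _ Gc0; have [oc0 _ c0K cc0 _] := chc0.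
pose Fh := c \o (fun p : G * M => a p.1 p.2) \o chart_inv (prod_chart c0 c).
pose L (q : G * 'rV[R]_n) : 'rV[R]_(d + n) := row_mx (c0 q.1) q.2.
(* Freezing the group coordinates at [c0 h] turns the derivative of [F h] into one of [Fh] along a
   direction of the second block. *)
have DE h y : chart_dom c0 h ->
    'D_(delta_mx 0 i) (F h) y = 'D_(delta_mx 0 (rshift d i)) Fh (L (h, y)).
  move=> c0h'; have FE z : F h z = Fh (row_mx (c0 h) z).
    by rewrite /Fh /F /= row_mxKl row_mxKr c0K ?inE.
  have LE (t : R) (v : 'rV[R]_n) : row_mx (c0 h) (t *: v + y) =
      t *: row_mx 0 v + L (h, y) by rewrite scale_row_mx add_row_mx scaler0 add0r.
  have -> : delta_mx 0 (rshift d i) = row_mx 0 (delta_mx 0 i) :> 'rV[R]_(d + n).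
    by rewrite delta_mx_rshift.
  rewrite /derive; set f := (X in lim (X @ _)).
  suff -> : f = fun t => t^-1 *:
      ((Fh \o shift (L (h, y))) (t *: row_mx 0 (delta_mx 0 i)) - Fh (L (h, y))).
    by [].
  by apply/funext => t; rewrite /f /shift /= !FE LE.
rewrite DE//.
have nc0 : \forall q \near (h0, c x), chart_dom c0 q.1.
  by apply: (@cvg_fst _ _ (nbhs h0) (nbhs (c x))); exact: open_nbhs_nbhs.
apply: (@cvg_trans _ ('D_(delta_mx 0 (rshift d i)) Fh (L q) @[q --> (h0, c x)])).
  by apply: near_eq_cvg; apply: filterS nc0 => -[h y] /= /DE ->.
apply: (@cvg_comp _ _ _ L ('D_(delta_mx 0 (rshift d i)) Fh) _
  (nbhs (L (h0, c x)))).
  have cc0h : c0 @ h0 --> c0 h0 by apply: cc0; rewrite inE.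
  apply: (@continuous_rV R _ _ L (h0, c x)) => j; case: (split_ordP j) => k ->.
    under [X in {for _, continuous X}]eq_fun do rewrite /L /= row_mxEl.
    apply: (@continuous_comp _ _ _ (fun p : G * 'rV[R]_n => c0 p.1)
      (fun u : 'rV[R]_d => u 0 k)); last exact: coord_continuous.
    by apply: (@continuous_comp _ _ _ fst c0) => //; exact: cvg_fst.
  under [X in {for _, continuous X}]eq_fun do rewrite /L /= row_mxEr.
  apply: (@continuous_comp _ _ _ snd
    (fun u : 'rV[R]_n => u 0 k)); last exact: coord_continuous.
  exact: cvg_snd.
have Pc : prod_atlas (atlas G) (atlas M) (prod_chart c0 c) by exists c0, c.
have dFh : differentiable ('D_(delta_mx 0 (rshift d i)) Fh) (L (h0, c x)).
  by apply: (sa _ _ Pc Mc [:: rshift d i]); exists (h0, x).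
exact: (differentiable_continuous dFh).
Qed.

(** The stabilizer is a projection of the preimage of the single point [(x, x)] under the proper
    map. *)
Lemma stabilizer_compact x : proper_action a -> compact [set h | a h x = x].
Proof.
move=> [_ pa].
have -> : [set h | a h x = x] =
    fst @` ((fun p : G * M => (a p.1 p.2, p.2)) @^-1` [set (x, x)]).
  apply/seteqP; split=> [h hx|_ [[h p] /= [hp px] <-]] /=.
    by exists (h, x) => //=; rewrite hx.
  by rewrite -{1}px.
apply: continuous_compact; last by apply: pa; exact: compact_set1.
by apply: continuous_subspaceT => q; exact: cvg_fst.
Qed.

(** One neighborhood of [c x] serves the whole stabilizer: this is the tube lemma for a compact set
    of group elements, fed with the joint continuity of the derivative. *)
Lemma charted_act_derive_near x (e : R) : proper_action a -> D x -> 0 < e ->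
  \forall y \near c x, forall h, a h x = x -> charted_dom h y /\
    forall i, `|'D_(delta_mx 0 i) (F h) y - 'D_(delta_mx 0 i) (F h) (c x)| <= e.
Proof.
move=> pa Dx e0.
have /compact_near_coveringP := stabilizer_compact (x := x) pa.
move=> /(_ _ (nbhs (c x)) (fun y h => charted_dom h y /\
    forall i, `|'D_(delta_mx 0 i) (F h) y - 'D_(delta_mx 0 i) (F h) (c x)| <= e)
    _) H; apply: H => h0 /= h0x.
have Dhx : D (a h0 x) by rewrite h0x.
have c1 i := @charted_act_derive_cvg h0 x i Dx Dhx.
have c2 i : 'D_(delta_mx 0 i) (F q.1) (c x) @[q --> (h0, c x)] -->
    'D_(delta_mx 0 i) (F h0) (c x).
  apply: (@cvg_comp _ _ _ (fun q : G * 'rV[R]_n => (q.1, c x))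
    (fun q : G * 'rV[R]_n => 'D_(delta_mx 0 i) (F q.1) q.2) _
    (nbhs (h0, c x))); last exact: c1.
  have q1 : q.1 @[q --> (h0, c x)] --> h0 by exact: cvg_fst.
  have q2 : c x @[q --> (h0, c x)] --> c x by exact: cvg_cst.
  exact: (cvg_pair q1 q2).
(* The derivatives of [F q.1] at [q.2] and at [c x] are both compared with that of [F h0] at [c x],
   at a cost of half of [e] each. *)
have e2 : 0 < e / 2 by rewrite divr_gt0.
suff : \forall q \near (h0, c x), charted_dom q.1 q.2 /\
    forall i, `|'D_(delta_mx 0 i) (F q.1) q.2 -
                'D_(delta_mx 0 i) (F q.1) (c x)| <= e by [].
have ni (i : 'I_n) : \forall q \near (h0, c x),
    `|'D_(delta_mx 0 i) (F q.1) q.2 - 'D_(delta_mx 0 i) (F q.1) (c x)| <= e.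
  have /cvgrPdist_le /(_ _ e2) n1 := c1 i.
  have /cvgrPdist_le /(_ _ e2) n2 := c2 i.
  apply: filterS2 n1 n2 => q q1 q2.
  rewrite -(subrKA ('D_(delta_mx 0 i) (F h0) (c x))) (splitr e).
  apply: le_trans (ler_normD _ _) _; apply: lerD; last exact: q2.
  by rewrite distrC; exact: q1.
have n0 := charted_dom_near Dx Dhx.
have n1 := filter_forall (nbhs_filter _) ni.
by apply: filterS2 n0 n1 => q; split.
Qed.

(** For [x] in the chart, this is the kernel of the isotropy representation of the stabilizer of [x]
    on the tangent space. *)
Definition tangent_id x (h : G) : Prop :=
  a h x = x /\ forall v, 'D_v (F h) (c x) = v.

Lemma near_id_tangent_id x h :
  D x -> (\forall p \near x, a h p = p) -> tangent_id x h.
Proof.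
move=> Dx hp; split=> [|v]; first exact: nbhs_singleton hp.
rewrite (@near_eq_derive _ _ _ _ id) ?derive_id//.
apply: filterS (chart_near Dx hp) => _ [p [Dp hpE] <-].
by rewrite charted_actE// hpE.
Qed.

Lemma tangent_idM x h k :
  D x -> tangent_id x h -> tangent_id x k -> tangent_id x (h * k)%g.
Proof.
move=> Dx [hx Dh] [kx Dk]; split=> [|v]; first by rewrite actM kx.
rewrite (@near_eq_derive _ _ _ _ (F h \o F k)); last first.
  have nD : \forall p \near x, D (a k p).
    have [oD _ _ _ _] := chc.
    by apply: (@act_continuous _ _ _ _ _ a k x); rewrite kx; exact: open_nbhs_nbhs.
  apply: filterS (chart_near Dx nD) => _ [p [Dp Dkp] <-].
  by rewrite /= !charted_actE// actM.
have dk : differentiable (F k) (c x) by apply: charted_act_diff; rewrite ?kx.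
have Fkx : F k (c x) = c x by rewrite charted_actE// kx.
have dh : differentiable (F h) (F k (c x)).
  by rewrite Fkx; apply: charted_act_diff; rewrite ?hx.
by rewrite (derive_comp v dk dh) Fkx Dk Dh.
Qed.

Lemma tangent_idX x g k : D x -> tangent_id x g -> tangent_id x (g ^+ k)%g.
Proof.
move=> Dx tg; elim: k => [|k IH].
  by apply: near_id_tangent_id => //; apply: nearW => p; rewrite expg0 act1.
by rewrite expgS; exact: tangent_idM.
Qed.

(* In a chart, the powers of g are uniformly C^1-close to the identity near x,
   since they stay in the compact stabilizer. So with w = g y - y, the steps
   g^(k+1) y - g^k y all stay within |w| / 2 of w, whereas g^k y - y stays
   bounded; hence w = 0. *)
Lemma tangent_id_near_id x g : proper_action a -> D x -> tangent_id x g ->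
  \forall p \near x, a g p = p.
Proof.
move=> pa Dx tg; have [gx _] := tg.
(* Summing [n] partial derivatives bounded by [e] must give at most one half; [n.+1] keeps [e]
   positive when [n] is 0. *)
pose e : R := (2 * n.+1%:R)^-1.
have e0 : 0 < e by rewrite invr_gt0 mulr_gt0.
have ne : n%:R * e <= 2^-1.
  rewrite /e invfM mulrCA ger_pMr ?invr_gt0// ler_pdivrMr// mul1r ler_nat.
  exact: leqnSn.
have /nbhs_ballP[r /= r0 Br] := charted_act_derive_near pa Dx e0.
(* The partial derivatives of [F h - id] vanish at [c x], hence are bounded by [e] on the ball, so
   this map has Lipschitz constant one half there. *)
have lip h : tangent_id x h -> forall y z, ball (c x) r y -> ball (c x) r z ->
    `|(F h y - F h z) - (y - z)| <= 2^-1 * `|y - z|.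
  move=> [hx Dh] y z By Bz.
  have dB p : ball (c x) r p -> differentiable (F h) p.
    by move=> /Br/(_ h hx)[[q [Dq Dhq] <-] _]; exact: charted_act_diff.
  have mv : forall p, ball (c x) r p -> differentiable (F h - id) p /\
      forall i, `|'D_(delta_mx 0 i) (F h - id) p| <= e.
    move=> p Bp; split=> [|i]; first by apply: differentiableB => //; exact: dB.
    rewrite deriveB; [|exact/diff_derivable/dB|exact: derivable_id].
    by rewrite derive_id -[X in _ - X]Dh; have [_] := Br _ Bp h hx; exact.
  have -> : F h y - F h z - (y - z) = (F h - id) y - (F h - id) z.
    by rewrite !fctE !opprD !opprK addrACA.
  apply: le_trans (mean_value_ineq (ltW e0) mv By Bz) _.
  by apply: ler_wpM2r.
have [oD _ _ _ _] := chc.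
have nB : nbhs x [set p | D p /\ ball (c x) r (c p)].
  by apply: near_chart => //; exact: nbhsx_ballx.
have nB' : nbhs x [set p | D (a g p) /\ ball (c x) r (c (a g p))].
  have cg : a g @ x --> x by rewrite -{2}gx; exact: act_continuous.
  exact: (cg _ nB).
apply: filterS2 nB nB' => p [Dp Bp] [Dgp Bgp].
have tgk k := tangent_idX k Dx tg.
(* The ball lies in the charted domain of every stabilizer element, so no power of [g] takes [p] out
   of the chart. *)
have Dgk k : D (a (g ^+ k)%g p).
  have [[q [Dq Dgq] cqp] _] := Br _ Bp _ (tgk k).1.
  by rewrite -(chartK Dp) -cqp chartK.
have w0 : c (a g p) - c p = 0.
  apply: (@bounded_drift_eq0 _ _ (fun k => c (a (g ^+ k)%g p)) _ (2^-1 * r)) => k.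
    rewrite expgSr actM -(charted_actE (g ^+ k)%g Dgp).
    by rewrite -(charted_actE (g ^+ k)%g Dp); exact: lip (tgk k) _ _ Bgp Bp.
  rewrite expg0 act1.
  (* Comparison with the fixed point [c x] bounds the displacement of [c p] under every power by
     half of its distance to [c x]. *)
  have := lip _ (tgk k) _ _ Bp (ballxx _ r0).
  have [gkx _] := tgk k; rewrite !charted_actE// gkx => le1.
  have -> : c (a (g ^+ k)%g p) - c p =
      c (a (g ^+ k)%g p) - c x - (c p - c x) by rewrite opprB addrA subrK.
  apply: le_trans le1 _; apply: ler_wpM2l; first by rewrite invr_ge0.
  by move: Bp; rewrite -ball_normE /ball_ /= distrC => /ltW.
by rewrite -(chartK Dgp) (subr0_eq w0) chartK.
Qed.

End ChartedAction.

(** * Freeness of the prolonged action *)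

Section Freeness.
Context {R : realType} {d n : nat} {G : lieGroupType R d}.
Context {M : smoothManifoldType R n}.
Variable a : smoothAction G M.

(** At interior points of the fixed point set, [g] fixes the point and has identity derivative; both
    conditions pass to limits by continuity, the targets being Hausdorff. *)
Lemma closure_near_id_tangent_id (c : chart R n M) (g : G) x :
  atlas M c -> chart_dom c x -> closure [set p | a g p = p]° x ->
  tangent_id a c x g.
Proof.
move=> Mc Dx clx; set Z := [set p | a g p = p]° in clx *.
have gx : a g x = x.
  apply: (@manifold_hausdorff R n M) => A B nA nB.
  have nA' : nbhs x (a g @^-1` A) := @act_continuous _ _ _ _ _ a g x _ nA.
  have [p [/interior_subset gp [Ap Bp]]] := clx _ (filterI nA' nB).
  by exists p; split=> //; rewrite -gp.
split=> // v.
have dg : differentiable (charted_act a c g) (c x).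
  by apply: charted_act_diff; rewrite ?gx.
rewrite (derive_delta_sum _ dg) [RHS]row_sum_delta.
apply: eq_bigr => i _; congr (_ *: _).
pose f := 'D_(delta_mx 0 i) (charted_act a c g).
have cf : {for c x, continuous f}.
  apply: differentiable_continuous.
  by apply: (@charted_act_smooth _ _ _ _ _ a c Mc g [:: i]); exists x; rewrite /= ?gx.
apply: (@norm_hausdorff _ 'rV[R]_n) => A B nA nB.
have nA' := near_chart Mc Dx (cf _ nA : nbhs (c x) (f @^-1` A)).
have [p [Zp [Dp Ap]]] := clx _ nA'.
exists (delta_mx 0 i); split; last exact: nbhs_singleton nB.
have [_ Dg] := near_id_tangent_id Mc Dp (Zp : \forall q \near p, a g q = q).
by rewrite -[delta_mx 0 i]Dg.
Qed.

(* phi is a diffeomorphism onto a neighborhood of x, so the chain rule cancels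
   its derivative from both sides of the equality of 1-jets. *)
Lemma jet_fixed_tangent_id (c : chart R n M) (g : G) phi k :
  atlas M c -> chart_dom c (phi 0) -> local_diffeo phi -> (0 < k)%N ->
  jet_eq k (a g \o phi) phi -> tangent_id a c (phi 0) g.
Proof.
move=> Mc Dx dphi k0 [/= gx E].
split=> // v; move: (dphi) => [U [V [psi [[oU U0 oV] UV VU [cphi sphi] [cpsi spsi]]]]].
have chc := atlas_chart _ Mc; have [oD _ _ _ _] := chc.
set x := phi 0 in gx Dx *.
have [Vx psi0] := UV _ U0.
(* [u] is [phi] in the chart and [w] its local inverse, so that [charted_act a c g] can be rewritten
   near [c x] as itself composed with [u] and then [w]. *)
pose u := c \o phi; pose w := psi \o chart_inv c.
have du : differentiable u 0.
  by apply: (sphi (id_chart R n) c erefl Mc [::]); exists 0.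
have dw : differentiable w (c x).
  by apply: (spsi c (id_chart R n) Mc erefl [::]); exists x.
have wx : w (c x) = 0 by rewrite /w /= chartK.
have nV : \forall p \near x, V p by exact: open_nbhs_nbhs.
have dF : differentiable (charted_act a c g) (u 0).
  by apply: charted_act_diff; rewrite ?gx.
(* Multi-indices of length one, admissible since [k] is positive, settle the basis directions;
   linearity in the direction gives the rest. *)
have Du z : 'D_z (charted_act a c g \o u) 0 = 'D_z u 0.
  rewrite derive_delta_sum; last exact: differentiable_comp.
  rewrite derive_delta_sum//; apply: eq_bigr => i _; congr (_ *: _).
  have := E c Mc _ [:: i] k0; rewrite /= gx => <- //.
  apply: near_eq_derive.
  have [U1 [oU1 U10 _ U1D]] :=
    local_diffeo_chart dphi Mc oD (@subset_refl _ _) Dx.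
  by apply: (nearU oU1 U10) => y /U1D Dy; rewrite /u /= charted_actE.
rewrite (@near_eq_derive _ _ _ _ ((charted_act a c g \o u) \o w)); last first.
  apply: filterS (chart_near Mc Dx nV) => _ [p [Dp Vp] <-].
  by rewrite /u /w /= chartK// (VU _ Vp).2 charted_actE.
have dFu : differentiable (charted_act a c g \o u) (w (c x)).
  by rewrite wx; exact: differentiable_comp.
have du' : differentiable u (w (c x)) by rewrite wx.
rewrite (derive_comp v dw dFu) wx Du -wx -(derive_comp v dw du').
rewrite (@near_eq_derive _ _ _ _ id) ?derive_id//.
apply: filterS (chart_near Mc Dx nV) => _ [p [Dp Vp] <-].
by rewrite /u /w /= chartK// (VU _ Vp).2.
Qed.

Lemma prolong_free k : proper_action a -> component_effective a ->
  (0 < k)%N -> free_action (prolong k a).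
Proof.
move=> pa ea k0 g j gj; apply: contrapT => g1.
pose Z := [set p | a g p = p]°.
pose x := frame_repr j 0.
have Zx : Z x.
  have [c Mc Dx] := @atlas_cover R n M x.
  apply: (@tangent_id_near_id _ _ _ _ _ a c) => //.
  apply: (@jet_fixed_tangent_id c g _ k) => //; first exact: frame_reprP.
  by have := frame_repr_prolong a g j; rewrite gj.
have cZ : closed Z.
  (* A limit point inherits the identity derivative, and this puts it back in the interior of the
     fixed point set. *)
  move=> p clp; have [c Mc Dp] := @atlas_cover R n M p.
  apply: (@tangent_id_near_id _ _ _ _ _ a c) => //.
  exact: closure_near_id_tangent_id.
have [p Cp gp] := ea g g1 x.
(* The component is connected and meets the open and closed set [Z] at [x], so [Z] contains all of
   it. *)
have CZ : connected_component setT x `&` Z = connected_component setT x.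
  apply: component_connected.
  - by exists x; split=> //; exact: connected_component_refl.
  - by exists Z => //; exact: open_interior.
  - by exists Z.
by apply: gp; move: Cp; rewrite -CZ => -[_ /interior_subset].
Qed.

End Freeness.

Theorem corollary5p6 (R : realType) (d n : nat)
    (G : lieGroupType R d) (M : smoothManifoldType R n)
    (a : smoothAction G M) :
  proper_action a -> component_effective a ->
  forall l : nat, (1 <= l)%N ->
    proper_action (prolong l a) /\ free_action (prolong l a).
Proof.
move=> pa ea l l0; split; first exact: prolong_proper.
exact: prolong_free.
Qed.
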